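(* Let $f$ be a $C^\infty$ function defined in an open set $\Omega\subset\mathbb{R}^2$ containing the origin, let $\Gamma=\{(t,\phi(t)):t\in I\}$ be an analytic curve in $\mathbb{R}^2$ passing through or ending at the origin, and let $E$ be a closed subset of $[0,2\pi]$ of positive capacity. For $\theta\in E$ let $\Gamma_\theta=\{(t\cos\theta+\phi(t)\sin\theta,\,-t\sin\theta+\phi(t)\cos\theta):t\in I\}$. Suppose that for each $\theta\in E$ there is a real analytic function $F_\theta$ defined in a neighborhood $Q_\theta$ of $\Gamma_\theta\cap\Omega$ in $\mathbb{R}^2$ such that $f$ and $F_\theta$ coincide on $\Gamma_\theta\cap\Omega$. Then there is an analytic function $F$ defined in some neighborhood $U$ of the origin that coincides with $f$ on $U\cap\Lambda$, where $\Lambda:=\bigcup_{\theta\in E}\Gamma_\theta$.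
   Context: Functions $f$, $F_\theta$, $F$ are complex-valued functions of real variables, and analytic means real analytic; $\phi$ is real-valued. Here $I\subset\mathbb{R}$ is a non-degenerate interval containing $0$ (as an interior point when the curve passes through the origin, as an endpoint when it ends at the origin), $\phi$ is real analytic on $I$ (including at endpoints belonging to $I$), and $\phi(0)=0$. Capacity means logarithmic capacity in $\mathbb{C}\supset\mathbb{R}$: for a compact set $E\subset\mathbb{C}$, $\operatorname{cap}(E)=\exp\left(-\min_{\mu}\sup_{z\in\mathbb{C}}p_\mu(z)\right)$, where $\mu$ ranges over probability measures on $E$ and $p_\mu(z)=\lim_{N\to\infty}\int\min\left(N,\log\frac{1}{|z-\zeta|}\right)d\mu(\zeta)$. *)

(* Defs.v *)
From HB Require Import structures.
From mathcomp Require Import all_boot all_order all_algebra.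
From mathcomp Require Import complex.
From mathcomp Require Import all_classical all_reals all_analysis.

Set Implicit Arguments.
Unset Strict Implicit.
Unset Printing Implicit Defensive.
Import Order.TTheory GRing.Theory Num.Theory numFieldNormedType.Exports.

Local Open Scope classical_set_scope.
Local Open Scope ring_scope.

(* Functions on a subset are represented by total functions; for open U, the
   predicates smooth_on U and analytic_on2 U do not depend on values off U. *)

Fixpoint Ck_on (R : realType) (k : nat) (U : set (R * R)) (g : R * R -> R)
    : Prop :=
  (forall p, U p -> {for p, continuous g}) /\
  if k is k'.+1 then
    [/\ forall p, U p ->
          derivable g p (1 : R, 0 : R) /\ derivable g p (0 : R, 1 : R),
        Ck_on k' U ('D_(1 : R, 0 : R) g)
      & Ck_on k' U ('D_(0 : R, 1 : R) g)]
  else True.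

Definition smooth_on (R : realType) (U : set (R * R)) (f : R * R -> R[i]) :=
  forall k, Ck_on k U (fun p => complex.Re (f p))
            /\ Ck_on k U (fun p => complex.Im (f p)).

(* The power series is required to converge on a two-sided neighbourhood of
   t0, and to represent g on the part of it lying in A: at an endpoint of an
   interval A this says that g extends analytically across the endpoint. *)
Definition analytic_on1 (R : realType) (A : set R) (g : R -> R) :=
  forall t0, A t0 -> exists (a : nat -> R) (r : R), 0 < r /\
    forall t, `|t - t0| < r ->
      cvgn (pseries a (t - t0)) /\
      (A t -> limn (pseries a (t - t0)) = g t).

(* Partial sums, by total degree, of the double power series
   \sum_(i, j) a i j * v.1 ^+ i * v.2 ^+ j. *)
Definition pseries2 (R : realType) (a : nat -> nat -> R) (v : R * R)
    : nat -> R :=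
  series (fun n => \sum_(i < n.+1) a i (n - i)%N * v.1 ^+ i * v.2 ^+ (n - i)).

(* The first conjunct is the absolute convergence of the double series, which
   makes its sum independent of the order of summation. *)
Definition analytic_at2 (R : realType) (g : R * R -> R) (p : R * R) :=
  exists (a : nat -> nat -> R) (r : R), 0 < r /\
    forall v : R * R, `|v.1| < r -> `|v.2| < r ->
      cvgn (pseries2 (fun i j => `|a i j|) (`|v.1|, `|v.2|)) /\
      limn (pseries2 a v) = g (p.1 + v.1, p.2 + v.2).

Definition analytic_on2 (R : realType) (U : set (R * R)) (F : R * R -> R[i]) :=
  forall p, U p -> analytic_at2 (fun q => complex.Re (F q)) p
                   /\ analytic_at2 (fun q => complex.Im (F q)) p.

(* Logarithmic capacity: the complex plane is identified with R * R, whose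
   product sigma-algebra is the Borel one; cmod is the complex modulus (the
   library norm on R * R is the max norm). *)
Definition cmod (R : realType) (z : R * R) : R :=
  Num.sqrt (z.1 ^+ 2 + z.2 ^+ 2).

Section capacity.
Local Open Scope ereal_scope.

(* log (1 / |z - w|) is written - lne |z - w|, which is +oo at w = z. *)
Definition log_potential (R : realType) (E : set (R * R))
    (mu : probability (R * R)%type R) (z : R * R) : \bar R :=
  limn (fun N : nat =>
    \int[mu]_(w in E)
      mine (N%:R)%:E (- lne (cmod (z.1 - w.1, z.2 - w.2)%R)%:E)).

(* A probability measure on the compact set E is a Borel probability measure
   on the plane giving E mass 1. If E is empty there is none, the infimum is
   +oo and the capacity is 0; otherwise the infimum is attained. *)
Definition log_capacity (R : realType) (E : set (R * R)) : \bar R :=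
  expeR (- ereal_inf
    [set ereal_sup (range (log_potential E mu)) |
       mu in [set mu : probability (R * R)%type R | mu E = 1]]).

End capacity.

Definition real_axis_set (R : realType) (E : set R) : set (R * R) :=
  [set (t, 0) | t in E].

Definition rot_curve (R : realType) (I : set R) (phi : R -> R) (theta : R)
    : set (R * R) :=
  [set (t * cos theta + phi t * sin theta, - t * sin theta + phi t * cos theta)
     | t in I].

(* Main.v *)
Require Import Defs.
From HB Require Import structures.
From mathcomp Require Import all_boot all_order all_algebra.
From mathcomp Require Import complex.
From mathcomp Require Import all_classical all_reals all_analysis.
From mathcomp Require Import measurable_realfun ring lra zify.

(** Taking real and imaginary parts, let g be a real smooth function and let
sum b_ij x^i y^j be its formal Taylor series at the origin. Everything follows
once this series converges: its sum F is then analytic near 0, and along each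
rotated curve both g and F are analytic in the parameter t with the same
Taylor coefficients at t = 0, so they agree on a whole interval of
parameters by the identity theorem. The length of this interval is the same
for all angles, because a rotation preserves the distance |(t, phi t)| >= |t|
to the origin; this is what gives one neighbourhood U for all the curves.

To bound the b_ij, write z = x + i y, so that the curve of angle theta is
z = e^(-i theta) psi(t) with psi(t) = t + i phi(t). Substituting into
sum a_kl z^(k-l) zbar^l gives a power series in t whose n-th coefficient
c_n(theta) is a trigonometric polynomial of degree at most n. There are three
steps.

1. For each theta in E, analyticity of g along the curve bounds c_n(theta) by
   m^(n+1) for some integer m depending on theta (coef_growth_bound). Let mu be
   a probability measure on E with bounded logarithmic potential; for some m
   the set B of angles with this bound has positive measure
   (uniform_bound_piece). The potential of mu restricted to B is still bounded,
   and averaging it over B shows that every product of |theta - alpha_i| is at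
   least delta^(number of factors) somewhere in B (capacity_product_ge).

2. This is what is needed for an inequality of Bernstein-Walsh type
   (bernstein_walsh_coef): a polynomial of degree d in e^(i theta) bounded by A
   on B has coefficients bounded by A L^d. So the coefficients h_(m,n) of the
   c_n, where m is the frequency, grow at most geometrically in n.

3. Grouping by frequency, sum_n h_(m,n) t^n is the sum of the terms
   a_kl psi^(k-l) psibar^l with k - 2l = m, that is psi^m times a series in
   powers of s = psi psibar. The coefficient a_kl of this series is a residue,
   2 a_kl = Res h_m psi^-(k-l+1) psibar^-(l+1) ds (residue_extract), where the
   factor 2 appears because s has a double zero at t = 0. As psi / t and
   psibar / t are invertible, the formula bounds a_kl, hence b_kl, geometrically
   (formal_series_bound).

One-variable germs are handled through their Taylor polynomials of all orders
with explicit errors, measured by the weighted norm sum |p_n| r^n on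
polynomials. This norm is submultiplicative, and all compositions of power
series reduce to polynomial identities with uniform bounds. *)

Import Order.TTheory GRing.Theory Num.Theory numFieldNormedType.Exports.
Local Open Scope classical_set_scope.
Local Open Scope ring_scope.

Set Implicit Arguments.
Unset Strict Implicit.

(** * Weighted norms of polynomials *)

Section WeightedNorm.
Variable K : numDomainType.
Implicit Types (p q : {poly K}) (r : K).

Definition wnorm r p : K := \sum_(i < size p) `|p`_i| * r ^+ i.

Lemma wnorm_wide r p n : (size p <= n)%N ->
  wnorm r p = \sum_(i < n) `|p`_i| * r ^+ i.
Proof.
move=> pn; rewrite /wnorm (big_ord_widen _ (fun i => `|p`_i| * r ^+ i) pn).
rewrite big_mkcond; apply: eq_bigr => i _; case: ltnP => // h.
by rewrite nth_default // normr0 mul0r.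
Qed.

Lemma wnorm_ge0 r p : 0 <= r -> 0 <= wnorm r p.
Proof. by move=> r0; apply: sumr_ge0 => i _; rewrite mulr_ge0 ?exprn_ge0. Qed.

Lemma wnormC r c : wnorm r c%:P = `|c|.
Proof.
rewrite (@wnorm_wide _ _ 1) ?size_polyC ?leq_b1 //.
by rewrite big_ord1 coefC expr0 mulr1.
Qed.

Lemma wnorm0 r : wnorm r 0 = 0.
Proof. by rewrite -polyC0 wnormC normr0. Qed.

Lemma wnorm1 r : wnorm r 1 = 1.
Proof. by rewrite -polyC1 wnormC normr1. Qed.

Lemma wnormXM r p : wnorm r ('X * p) = r * wnorm r p.
Proof.
have [->|p0] := eqVneq p 0; first by rewrite mulr0 wnorm0 mulr0.
rewrite (@wnorm_wide _ _ (size p).+1); last by rewrite -commr_polyX size_mulX.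
rewrite big_ord_recl coefXM eqxx normr0 mul0r add0r mulr_sumr.
by apply: eq_bigr => i _; rewrite coefXM /= exprS mulrCA.
Qed.

Lemma wnormX r : wnorm r 'X = r.
Proof. by rewrite -['X]mulr1 wnormXM wnorm1 mulr1. Qed.

Lemma wnormD r p q : 0 <= r -> wnorm r (p + q) <= wnorm r p + wnorm r q.
Proof.
move=> r0; pose n := maxn (size p) (size q).
rewrite !(@wnorm_wide _ _ n) ?leq_maxl ?leq_maxr ?size_polyD //.
rewrite -big_split; apply: ler_sum => i _ /=.
by rewrite coefD -mulrDl ler_wpM2r ?exprn_ge0 ?ler_normD.
Qed.

Lemma wnormN r p : wnorm r (- p) = wnorm r p.
Proof.
rewrite (@wnorm_wide _ _ (size p)) ?size_polyN //.
by apply: eq_bigr => i _; rewrite coefN normrN.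
Qed.

Lemma wnormB r p q : 0 <= r -> wnorm r (p - q) <= wnorm r p + wnorm r q.
Proof. by move=> r0; rewrite -(wnormN r q) wnormD. Qed.

Lemma wnormZ r c p : wnorm r (c *: p) = `|c| * wnorm r p.
Proof.
rewrite (@wnorm_wide _ _ (size p)) ?size_scale_leq // mulr_sumr.
by apply: eq_bigr => i _; rewrite coefZ normrM mulrA.
Qed.

Lemma wnorm_sum r (J : Type) (s : seq J) (P : pred J) (F : J -> {poly K}) :
  0 <= r -> wnorm r (\sum_(j <- s | P j) F j) <= \sum_(j <- s | P j) wnorm r (F j).
Proof.
move=> r0; elim/big_ind2 : _ => //; first by rewrite wnorm0.
by move=> x u y v hx hy; apply: le_trans (wnormD _ _ r0) (lerD _ _).
Qed.

Lemma wnormM r p q : 0 <= r -> wnorm r (p * q) <= wnorm r p * wnorm r q.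
Proof.
move=> r0; elim/poly_ind: p => [|p c IH]; first by rewrite !(mul0r, wnorm0).
have -> : wnorm r (p * 'X + c%:P) = r * wnorm r p + `|c|.
  have [->|p0] := eqVneq p 0; first by rewrite mul0r add0r wnormC wnorm0 mulr0 add0r.
  rewrite (@wnorm_wide _ _ (size p).+1); last first.
    by rewrite size_MXaddC (negbTE p0).
  rewrite big_ord_recl coefD coefMX coefC eqxx add0r expr0 mulr1 addrC mulr_sumr.
  congr (_ + _); apply: eq_bigr => i _.
  by rewrite coefD coefMX coefC /= addr0 exprS mulrCA.
rewrite mulrDl commr_polyX -mulrA mul_polyC.
apply: le_trans (wnormD _ _ r0) _; rewrite wnormXM wnormZ mulrDl lerD2r -mulrA.
exact: ler_wpM2l.
Qed.

Lemma wnormX_le r p n : 0 <= r -> wnorm r (p ^+ n) <= wnorm r p ^+ n.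
Proof.
move=> r0; elim: n => [|n IH]; first by rewrite !expr0 wnorm1.
rewrite !exprS; apply: le_trans (wnormM _ _ r0) _.
by apply: ler_wpM2l => //; exact: wnorm_ge0.
Qed.

Lemma coef_wnorm r p n : 0 <= r -> `|p`_n| * r ^+ n <= wnorm r p.
Proof.
move=> r0; case: (ltnP n (size p)) => h; last first.
  by rewrite nth_default // normr0 mul0r wnorm_ge0.
rewrite /wnorm (bigD1 (Ordinal h)) //= lerDl sumr_ge0 // => i _.
by rewrite mulr_ge0 ?exprn_ge0.
Qed.

Lemma horner_wnorm p x : `|p.[x]| <= wnorm `|x| p.
Proof.
rewrite horner_coef; apply: le_trans (ler_norm_sum _ _ _) _.
by apply: ler_sum => i _; rewrite normrM normrX.
Qed.

Lemma ler_wnorm r r' p : 0 <= r -> r <= r' -> wnorm r p <= wnorm r' p.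
Proof.
move=> r0 rr; apply: ler_sum => i _; apply: ler_wpM2l => //.
by apply: lerXn2r; rewrite ?nnegrE // (le_trans r0).
Qed.

Lemma wnorm_poly r n (E : nat -> K) :
  wnorm r (\poly_(i < n) E i) = \sum_(i < n) `|E i| * r ^+ i.
Proof.
rewrite (@wnorm_wide _ _ n) ?size_poly //.
by apply: eq_bigr => i _; rewrite coef_poly ltn_ord.
Qed.

End WeightedNorm.

(** * Taylor polynomials with error bounds *)

Section Jets.
Variable R : realType.
Implicit Types (D : set R) (r M t : R) (p q : {poly R}) (H : R -> R) (N : nat).

(** The polynomial p has no degree bound: only its coefficients of order
below N carry information about H. Keeping the higher ones makes the product
of two jets the plain product of polynomials, while M bounds the norm of p
together with the size of the error. *)
Definition jet D r N H p M := exists e : R, [/\ 0 <= e, wnorm r p + e <= M &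
  forall t, D t -> `|t| <= r -> `|H t - p.[t]| <= e * (`|t| / r) ^+ N].

Lemma frac_le1 r t : 0 < r -> `|t| <= r -> 0 <= `|t| / r <= 1.
Proof.
by move=> r0 tr; rewrite divr_ge0 ?(ltW r0) //= ler_pdivrMr // mul1r.
Qed.

Lemma jet_le D r N H p M M' : M <= M' -> jet D r N H p M -> jet D r N H p M'.
Proof. by move=> MM [e [e0 he h]]; exists e; split=> //; exact: le_trans MM. Qed.

Lemma eq_jet D r N H H' p M : (forall t, D t -> `|t| <= r -> H t = H' t) ->
  jet D r N H p M -> jet D r N H' p M.
Proof.
by move=> HH [e [e0 he h]]; exists e; split=> // t Dt tr; rewrite -HH // h.
Qed.

Lemma jet_poly D r N p : jet D r N (horner p) p (wnorm r p).
Proof.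
by exists 0; split=> //; [rewrite addr0|move=> t _ _; rewrite subrr normr0 mul0r].
Qed.

Lemma jet_const D r N (c : R) : jet D r N (fun=> c) c%:P `|c|.
Proof.
rewrite -(wnormC r); apply: eq_jet (jet_poly _ _ _ _) => t _ _.
by rewrite hornerC.
Qed.

Lemma jet_norm_le D r N H p M t : 0 < r -> jet D r N H p M ->
  D t -> `|t| <= r -> `|H t| <= M.
Proof.
move=> r0 [e [e0 he h]] Dt tr; apply: le_trans he.
rewrite -(subrK p.[t] (H t)) addrC; apply: le_trans (ler_normD _ _) _.
apply: lerD; first exact: le_trans (horner_wnorm _ _) (ler_wnorm _ (normr_ge0 _) tr).
apply: le_trans (h _ Dt tr) _.
have /andP[f0 f1] := frac_le1 r0 tr.
by rewrite ler_piMr // exprn_ile1.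
Qed.

Lemma jetD D r N H H' p p' M M' : 0 < r ->
  jet D r N H p M -> jet D r N H' p' M' ->
  jet D r N (fun t => H t + H' t) (p + p') (M + M').
Proof.
move=> r0 [e [e0 he h]] [e' [e0' he' h']]; exists (e + e'); split.
- exact: addr_ge0.
- have := wnormD p p' (ltW r0); lra.
move=> t Dt tr; rewrite hornerD opprD addrACA mulrDl.
by apply: le_trans (ler_normD _ _) (lerD _ _); [exact: h|exact: h'].
Qed.

(** Writing H = p + O(e) and H' = p' + O(e'), the cross terms of the
product contribute e (|p'| + e') + |p| e', so the total is at most
(|p| + e) (|p'| + e'): the bound is submultiplicative with constant 1. Hence
powers and power series of jets keep geometric bounds. *)
Lemma jetM D r N H H' p p' M M' : 0 < r ->
  jet D r N H p M -> jet D r N H' p' M' ->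
  jet D r N (fun t => H t * H' t) (p * p') (M * M').
Proof.
move=> r0 [e [e0 he h]] J'; have [e' [e0' he' h']] := J'.
have w0 := wnorm_ge0 p (ltW r0); have w0' := wnorm_ge0 p' (ltW r0).
exists (e * (wnorm r p' + e') + wnorm r p * e'); split.
- by rewrite addr_ge0 ?mulr_ge0 ?addr_ge0.
- apply: (@le_trans _ _ ((wnorm r p + e) * (wnorm r p' + e'))).
    have := wnormM p p' (ltW r0); lra.
  by apply: ler_pM => //; rewrite addr_ge0.
move=> t Dt tr; rewrite hornerM.
have -> : H t * H' t - p.[t] * p'.[t] =
    (H t - p.[t]) * H' t + p.[t] * (H' t - p'.[t]) by ring.
rewrite [leRHS]mulrDl; apply: le_trans (ler_normD _ _) (lerD _ _); rewrite normrM.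
  rewrite mulrAC; apply: ler_pM => //; first exact: h.
  by apply: (jet_norm_le r0 (p := p') (N := N)) Dt tr; exists e'; split.
rewrite -mulrA; apply: ler_pM => //; last exact: h'.
exact: le_trans (horner_wnorm _ _) (ler_wnorm _ (normr_ge0 _) tr).
Qed.

Lemma jetZ D r N H p M c : 0 < r -> jet D r N H p M ->
  jet D r N (fun t => c * H t) (c *: p) (`|c| * M).
Proof. by move=> r0 J; rewrite -mul_polyC; apply: jetM => //; exact: jet_const. Qed.

Lemma jet_exp D r N H p M n : 0 < r -> jet D r N H p M ->
  jet D r N (fun t => H t ^+ n) (p ^+ n) (M ^+ n).
Proof.
move=> r0 J; elim: n => [|n IH].
  by rewrite !expr0 -[X in jet _ _ _ _ _ X]normr1; exact: jet_const.
rewrite !exprS; apply: eq_jet (jetM r0 J IH) => t _ _.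
by rewrite exprS.
Qed.

Lemma jet_sum D r N n (H : nat -> R -> R) (p : nat -> {poly R}) (M : nat -> R) :
  0 < r -> (forall i, (i < n)%N -> jet D r N (H i) (p i) (M i)) ->
  jet D r N (fun t => \sum_(i < n) H i t) (\sum_(i < n) p i) (\sum_(i < n) M i).
Proof.
move=> r0; elim: n => [|n IH] h.
  rewrite !big_ord0; apply: (@jet_le _ _ _ _ _ `|0|); first by rewrite normr0.
  by apply: eq_jet (jet_const _ _ _ _) => t _ _; rewrite big_ord0.
rewrite !big_ord_recr /=; apply: eq_jet; last first.
  apply: jetD => //; last exact: (h n).
  by apply: IH => i ni; apply: h; rewrite ltnS ltnW.
by move=> t _ _; rewrite big_ord_recr.
Qed.

Lemma jet_perturb D r N H H' p M e : 0 <= e -> jet D r N H p M ->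
  (forall t, D t -> `|t| <= r -> `|H' t - H t| <= e * (`|t| / r) ^+ N) ->
  jet D r N H' p (M + e).
Proof.
move=> e0 [e1 [e10 he h]] h'; exists (e1 + e); split.
- exact: addr_ge0.
- by rewrite addrA lerD2r.
move=> t Dt tr; rewrite [leRHS]mulrDl [leRHS]addrC.
rewrite -(subrK (H t) (H' t)) -addrA.
by apply: le_trans (ler_normD _ _) (lerD _ _); [exact: h'|exact: h].
Qed.

Lemma horner_norm_flat p r t N : 0 < r -> `|t| <= r ->
  (forall n, (n < N)%N -> p`_n = 0) ->
  `|p.[t]| <= wnorm r p * (`|t| / r) ^+ N.
Proof.
move=> r0 tr p0; have /andP[f0 f1] := frac_le1 r0 tr.
rewrite horner_coef /wnorm mulr_suml; apply: le_trans (ler_norm_sum _ _ _) _.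
apply: ler_sum => i _; have [iN|Ni] := ltnP i N.
  by rewrite p0 // mul0r normr0 !mul0r.
rewrite normrM normrX -mulrA; apply: ler_wpM2l => //.
have -> : `|t| ^+ i = r ^+ i * (`|t| / r) ^+ i.
  by rewrite expr_div_n mulrC divfK // expf_neq0 // gt_eqF.
apply: ler_wpM2l; first by rewrite exprn_ge0 // ltW.
exact: ler_wiXn2l.
Qed.

Lemma jet_norm_coef0 D r N H p M t : 0 < r -> (0 < N)%N ->
  jet D r N H p M -> p`_0 = 0 -> D t -> `|t| <= r -> `|H t| <= M * (`|t| / r).
Proof.
move=> r0; case: N => // N _ [e [e0 he h]] p0 Dt tr.
have /andP[f0 f1] := frac_le1 r0 tr.
apply: (@le_trans _ _ ((wnorm r p + e) * (`|t| / r))); last exact: ler_wpM2r.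
rewrite -(subrK p.[t] (H t)) addrC mulrDl.
apply: le_trans (ler_normD _ _) (lerD _ _); last first.
  apply: le_trans (h _ Dt tr) _; apply: ler_wpM2l => //.
  by rewrite exprS ler_piMr // exprn_ile1.
rewrite -[`|t| / r]expr1; apply: horner_norm_flat => //.
by case.
Qed.

Lemma wnorm_shrink p r l : 0 < r -> 0 <= l <= 1 -> p`_0 = 0 ->
  wnorm (l * r) p <= l * wnorm r p.
Proof.
move=> r0 /andP[l0 l1] p0; rewrite /wnorm mulr_sumr; apply: ler_sum => i _.
case: i => -[|i] /= _; first by rewrite p0 normr0 !mul0r mulr0.
rewrite exprMn [leRHS]mulrCA; apply: ler_wpM2l => //.
apply: ler_wpM2r; first by rewrite exprn_ge0 // ltW.
by rewrite exprS ler_piMr // exprn_ile1.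
Qed.

(** A germ vanishing at 0 has a norm proportional to the radius; this is
how the inner functions of a composition are made small. *)
Lemma jet_shrink D r N H p M l : 0 < r -> 0 < l <= 1 -> (0 < N)%N ->
  p`_0 = 0 -> jet D r N H p M -> jet D (l * r) N H p (l * M).
Proof.
move=> r0 /andP[l0 l1] N0 p0 [e [e0 he h]]; exists (l * e); split.
- by rewrite mulr_ge0 // ltW.
- apply: (@le_trans _ _ (l * (wnorm r p + e))); last by rewrite ler_pM2l.
  by rewrite mulrDr lerD2r wnorm_shrink // (ltW l0).
move=> t Dt tr.
have lrr : l * r <= r by rewrite ler_piMl // ltW.
apply: le_trans (h _ Dt (le_trans tr lrr)) _.
rewrite -mulrA mulrCA; apply: ler_wpM2l => //.
have lr0 : 0 < l * r by rewrite mulr_gt0.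
have /andP[f0 f1] := frac_le1 lr0 tr.
have -> : `|t| / r = l * (`|t| / (l * r)).
  by field; rewrite !gt_eqF.
rewrite exprMn; apply: ler_wpM2r; first exact: exprn_ge0.
by case: N N0 {h} => // N _; rewrite exprS ler_piMr ?exprn_ile1 // ltW.
Qed.

Lemma jet_coef0 D r N H p M : (0 < N)%N -> 0 < r -> D 0 ->
  jet D r N H p M -> p`_0 = H 0.
Proof.
case: N => // N _ r0 D0 [e [e0 he h]].
have := h 0 D0; rewrite normr0 mul0r expr0n mulr0 (ltW r0) => /(_ isT).
by rewrite normr_le0 subr_eq0 => /eqP ->; rewrite horner_coef0.
Qed.

(** The domain may be one-sided, as when the curve ends at the origin. *)
Definition accum0 D := forall eps : R, 0 < eps -> exists t, D t /\ 0 < `|t| < eps.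

(** The constant term is at most a constant times |t| for arbitrarily
small t in D, so it vanishes; then divide by t and repeat. *)
Lemma flat_poly_coef0 D q C rho N : accum0 D -> 0 < rho ->
  (forall t, D t -> 0 < `|t| <= rho -> `|q.[t]| <= C * `|t| ^+ N) ->
  forall n, (n < N)%N -> q`_n = 0.
Proof.
move=> aD rho0; elim: N q => // N IH q hq.
have [t1 [Dt1 /andP[t10 t11]]] := aD _ rho0.
have C0 : 0 <= C.
  rewrite -(pmulr_lge0 _ (exprn_gt0 N.+1 t10)).
  have := hq _ Dt1; rewrite t10 (ltW t11) => /(_ isT).
  exact: le_trans (normr_ge0 _).
have [q1 Eq] : exists q1, q = q1 * 'X + (q`_0)%:P.
  elim/poly_ind: q {hq IH} => [|q1 c _].
    by exists 0; rewrite mul0r add0r coef0.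
  by exists q1; rewrite coefD coefMX coefC eqxx add0r.
set c := q`_0 in Eq.
have c0 : c = 0.
  apply/eqP; apply: contraT => c0.
  pose B := C * rho ^+ N + wnorm rho q1 + 1.
  have B0 : 0 < B.
    rewrite ltr_wpDl // addr_ge0 ?mulr_ge0 ?exprn_ge0 ?(ltW rho0) //.
    by rewrite wnorm_ge0 // ltW.
  have e0 : 0 < Num.min rho (`|c| / B).
    by rewrite lt_min rho0 divr_gt0 // normr_gt0.
  have [t [Dt /andP[t0]]] := aD _ e0.
  rewrite lt_min => /andP[tr]; rewrite ltr_pdivlMr // => tc.
  have tr' : 0 < `|t| <= rho by rewrite t0 ltW.
  have := hq _ Dt tr'; rewrite {1}Eq !hornerE => h.
  have h1 : `|q1.[t]| <= wnorm rho q1.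
    exact: le_trans (horner_wnorm _ _) (ler_wnorm _ (normr_ge0 _) (ltW tr)).
  have h4 : `|c| <= `|q1.[t] * t + c| + `|q1.[t]| * `|t|.
    rewrite -normrM -{1}(addKr (q1.[t] * t) c) addrC.
    exact: ler_normB.
  have h2 : C * `|t| ^+ N.+1 <= C * rho ^+ N * `|t|.
    rewrite exprSr mulrA ler_wpM2r // ler_wpM2l // lerXn2r ?nnegrE //.
    - exact: ltW.
    - exact: ltW.
  have h3 : `|q1.[t]| * `|t| <= wnorm rho q1 * `|t| by rewrite ler_wpM2r.
  rewrite /B in tc; lra.
case=> // n; rewrite ltnS => nN; rewrite Eq c0 addr0 coefMX /=.
apply: IH nN => t Dt tr.
have /andP[t0 _] := tr.
have := hq _ Dt tr; rewrite Eq c0 addr0 hornerMX normrM exprSr mulrA.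
by rewrite ler_pM2r.
Qed.

End Jets.

(** * Power series in one and two variables *)

Section Expansions.
Variable R : realType.
Implicit Types (D : set R) (r s M t : R) (p q : {poly R}) (H : R -> R) (N : nat).
Implicit Types (b : nat -> nat -> R).

Definition psum2 b N (x y : R) : R :=
  \sum_(n < N) \sum_(i < n.+1) b i (n - i)%N * x ^+ i * y ^+ (n - i).

Definition psum2_poly b N (p q : {poly R}) : {poly R} :=
  \sum_(n < N) \sum_(i < n.+1) b i (n - i)%N *: (p ^+ i * q ^+ (n - i)).

Definition psum2_abs b N s : R :=
  \sum_(n < N) \sum_(i < n.+1) `|b i (n - i)%N| * s ^+ n.

(** Only one order N is involved: a smooth function satisfies such a bound
for each N, with s and M depending on N, and an analytic one with s and M
independent of N. *)
Definition expands_to (g : R * R -> R) (p : R * R) b s M N :=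
  psum2_abs b N s <= M /\
  forall x y, `|x| <= s -> `|y| <= s ->
    `|g (p.1 + x, p.2 + y) - psum2 b N x y| <= M * (Num.max `|x| `|y| / s) ^+ N.

(** Each monomial of the truncated outer series has a jet by
submultiplicativity, and the remainder of the outer series is absorbed because
|x| and |y| are at most s |t| / r. *)
Lemma jet_comp2 D r N b s M (g : R * R -> R) (c : R * R)
    (x y : R -> R) px py :
  0 < r -> 0 < s -> 0 <= M -> expands_to g c b s M N ->
  jet D r N x px s -> jet D r N y py s ->
  (forall t, D t -> `|t| <= r -> `|x t| <= s * (`|t| / r)) ->
  (forall t, D t -> `|t| <= r -> `|y t| <= s * (`|t| / r)) ->
  jet D r N (fun t => g (c.1 + x t, c.2 + y t)) (psum2_poly b N px py) (M + M).
Proof.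
move=> r0 s0 M0 [hM hg] jx jy hx hy.
apply: (@jet_perturb _ _ _ _ (fun t => psum2 b N (x t) (y t))) => //; last first.
  move=> t Dt tr; have /andP[f0 f1] := frac_le1 r0 tr.
  have xt := hx _ Dt tr; have yt := hy _ Dt tr.
  have xs : `|x t| <= s by apply: le_trans xt _; rewrite ler_piMr // ltW.
  have ys : `|y t| <= s by apply: le_trans yt _; rewrite ler_piMr // ltW.
  apply: le_trans (hg _ _ xs ys) _.
  apply: ler_wpM2l => //; apply: lerXn2r; rewrite ?nnegrE //.
    by rewrite divr_ge0 ?(ltW s0) // le_max normr_ge0.
  by rewrite ler_pdivrMr // mulrC ge_max xt yt.
apply: jet_le hM _.
apply: (@jet_sum _ D r N N
  (fun n t => \sum_(i < n.+1) b i (n - i)%N * x t ^+ i * y t ^+ (n - i))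
  (fun n => \sum_(i < n.+1) b i (n - i)%N *: (px ^+ i * py ^+ (n - i)))
  (fun n => \sum_(i < n.+1) `|b i (n - i)%N| * s ^+ n)) => // n _.
apply: (@jet_sum _ D r N n.+1 (fun i t => b i (n - i)%N * x t ^+ i * y t ^+ (n - i))
  (fun i => b i (n - i)%N *: (px ^+ i * py ^+ (n - i)))
  (fun i => `|b i (n - i)%N| * s ^+ n)) => // i.
rewrite ltnS => ni.
have -> : s ^+ n = s ^+ i * s ^+ (n - i) by rewrite -exprD subnKC.
apply: eq_jet (jetZ _ r0 (jetM r0 (jet_exp i r0 jx) (jet_exp (n - i) r0 jy))).
by move=> t _ _; rewrite mulrA.
Qed.

Lemma sum_geo_le (x : R) N K : 0 <= x <= 2^-1 ->
  \sum_(N <= n < K) x ^+ n <= 2 * x ^+ N.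
Proof.
move=> /andP[x0 x1]; have [KN|NK] := leqP K N.
  by rewrite big_geq // mulr_ge0 // exprn_ge0.
suff : \sum_(N <= n < K) x ^+ n + 2 * x ^+ K <= 2 * x ^+ N.
  by apply: le_trans; rewrite lerDl mulr_ge0 // exprn_ge0.
elim: K NK => // K IH; rewrite ltnS leq_eqVlt => /predU1P[<-|NK].
  rewrite big_nat1 exprSr; have := exprn_ge0 N x0; nra.
apply: le_trans (IH NK); rewrite big_nat_recr ?(ltnW NK) //= exprSr.
have := exprn_ge0 K x0; nra.
Qed.

(** Closed bounds pass to limits; all infinite sums below are handled in
this way. *)
Lemma lim_dist_le (u : nat -> R) (c e : R) N : cvgn u ->
  (forall K, (N <= K)%N -> `|u K - c| <= e) -> `|limn u - c| <= e.
Proof.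
move=> cu h.
have cu' : (fun n => `|u n - c|) @ \oo --> `|limn u - c|.
  by apply: cvg_norm; apply: cvgB => //; exact: cvg_cst.
rewrite -(cvg_lim _ cu') //; apply: limr_le.
  by apply/cvg_ex; exists `|limn u - c|.
by exists N.
Qed.

(** The terms a_n r1^n are bounded at a point r1 of convergence, so
halving the radius makes both the norm and the tail geometric. *)
Lemma analytic_on1_jet (A : set R) (g : R -> R) (t0 : R) :
  analytic_on1 A g -> A t0 ->
  exists (a : nat -> R) (r M : R), [/\ 0 < r, 0 <= M &
    forall N, jet [set t | A (t0 + t)] r N (fun t => g (t0 + t))
                  (\poly_(i < N) a i) M].
Proof.
move=> ang At0; have [a [r [r0 har]]] := ang _ At0.
pose r1 := r / 2; have r10 : 0 < r1 by rewrite divr_gt0.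
have c1 : cvgn (pseries a r1).
  have [] := har (t0 + r1); rewrite addrC addKr // gtr0_norm //.
  by rewrite /r1; lra.
have := cvg_series_bounded c1.
move=> [B0 [_ hB0]].
pose B := `|B0| + 1.
have hB n : `|a n| * r1 ^+ n <= B.
  have := hB0 B; rewrite /B ltr_pwDr ?ler_norm // => /(_ isT) /(_ n I).
  by rewrite /= normrM normrX (gtr0_norm r10).
have B0' : 0 <= B by rewrite addr_ge0.
pose r2 := r1 / 2; have r20 : 0 < r2 by rewrite divr_gt0.
have hB2 n : `|a n| * r2 ^+ n <= B * 2^-1 ^+ n.
  by rewrite /r2 exprMn mulrA ler_wpM2r // exprn_ge0.
exists a, r2, (2 * B + 2 * B); split=> // [|N].
  by rewrite addr_ge0 // mulr_ge0.
exists (2 * B); split=> //; first by rewrite mulr_ge0.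
  rewrite lerD2r wnorm_poly.
  apply: (@le_trans _ _ (\sum_(0 <= i < N) B * 2^-1 ^+ i)).
    by rewrite big_mkord; apply: ler_sum => i _.
  rewrite -mulr_sumr mulrC ler_wpM2r //.
  by have := @sum_geo_le 2^-1 0 N; rewrite expr0 mulr1; apply; rewrite lexx invr_ge0 ler0n.
move=> t /= At tr.
have := har (t0 + t); rewrite [t0 + t - t0]addrC addKr => -[|ct /(_ At) <-].
  by apply: le_lt_trans tr _; rewrite /r2 /r1; lra.
apply: (@lim_dist_le _ _ _ N) => // K NK.
have -> : (\poly_(i < N) a i).[t] = pseries a t N.
  by rewrite horner_poly /pseries /series /= big_mkord.
rewrite /pseries sub_series_geq //.
apply: le_trans (ler_norm_sum _ _ _) _.
apply: (@le_trans _ _ (\sum_(N <= n < K) B * (`|t| / r1) ^+ n)).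
  rewrite big_nat [leRHS]big_nat; apply: ler_sum => n _.
  rewrite normrM normrX expr_div_n mulrCA [leRHS]mulrC ler_wpM2r ?exprn_ge0 //.
  by rewrite ler_pdivlMr ?exprn_gt0.
have t1 : 0 <= `|t| / r1 <= 2^-1.
  rewrite divr_ge0 ?(ltW r10) //= ler_pdivrMr //.
  by apply: le_trans tr _; rewrite /r2 mulrC.
rewrite -mulr_sumr; apply: le_trans (ler_wpM2l B0' (sum_geo_le _ _ t1)) _.
rewrite mulrA [B * 2]mulrC ler_wpM2l ?mulr_ge0 //.
have /andP[t2 _] := t1.
apply: lerXn2r; rewrite ?nnegrE //; first by rewrite divr_ge0 // ltW.
by rewrite ler_wpM2l // lef_pV2 ?posrE // /r2; lra.
Qed.

Lemma pseries2E b (v : R * R) N : pseries2 b v N = psum2 b N v.1 v.2.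
Proof. by rewrite /pseries2 /series /= big_mkord. Qed.

Lemma psum2_absE b s N : psum2_abs b N s = psum2 (fun i j => `|b i j|) N s s.
Proof.
apply: eq_bigr => n _; apply: eq_bigr => i _.
by rewrite -mulrA -exprD subnKC // -ltnS.
Qed.

(** The terms of order n >= N carry a factor (max / s)^n, at most
(max / s)^N. *)
Lemma psum2_diff_le b N K s M x y : 0 < s -> (N <= K)%N ->
  psum2_abs b K s <= M -> `|x| <= s -> `|y| <= s ->
  `|psum2 b K x y - psum2 b N x y| <= M * (Num.max `|x| `|y| / s) ^+ N.
Proof.
move=> s0 NK hM xs ys; set m := Num.max _ _.
have m0 : 0 <= m by rewrite le_max normr_ge0.
have ms : m <= s by rewrite ge_max xs ys.
have f1 : 0 <= m / s <= 1 by rewrite divr_ge0 ?(ltW s0) //= ler_pdivrMr // mul1r.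
have /andP[f0 f2] := f1.
have E (F : nat -> R) : \sum_(n < K) F n - \sum_(n < N) F n = \sum_(N <= n < K) F n.
  rewrite -(big_mkord xpredT F) -(big_mkord xpredT F) (big_cat_nat (n := N)) //=.
  by rewrite addrAC subrr add0r.
rewrite /psum2 (E (fun n => \sum_(i < n.+1) b i (n - i)%N * x ^+ i * y ^+ (n - i))).
apply: (@le_trans _ _ (psum2_abs b K s * (m / s) ^+ N)); last first.
  by rewrite ler_wpM2r // exprn_ge0.
have -> : psum2_abs b K s =
    psum2_abs b N s + \sum_(N <= n < K) \sum_(i < n.+1) `|b i (n - i)%N| * s ^+ n.
  by rewrite -(E (fun n => \sum_(i < n.+1) `|b i (n - i)%N| * s ^+ n)) addrC subrK.
rewrite mulrDl.
apply: le_trans (ler_norm_sum _ _ _) _; rewrite ler_wpDl //.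
  rewrite mulr_ge0 ?exprn_ge0 // sumr_ge0 // => n _; rewrite sumr_ge0 // => i _.
  by rewrite mulr_ge0 // exprn_ge0 // ltW.
rewrite mulr_suml big_nat [leRHS]big_nat; apply: ler_sum => n /andP[Nn _].
apply: le_trans (ler_norm_sum _ _ _) _; rewrite mulr_suml; apply: ler_sum => i _.
rewrite !normrM !normrX -!mulrA ler_wpM2l //.
apply: (@le_trans _ _ (m ^+ n)).
  have -> : m ^+ n = m ^+ i * m ^+ (n - i) by rewrite -exprD subnKC // -ltnS.
  apply: ler_pM; rewrite ?exprn_ge0 //; apply: lerXn2r; rewrite ?nnegrE //.
    by rewrite le_max lexx.
  by rewrite le_max lexx orbT.
have -> : m ^+ n = s ^+ n * (m / s) ^+ n.
  by rewrite expr_div_n mulrC divfK // expf_neq0 // gt_eqF.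
by rewrite ler_wpM2l ?exprn_ge0 ?(ltW s0) // ler_wiXn2l.
Qed.

Lemma analytic_at2_expands (g : R * R -> R) (p : R * R) : analytic_at2 g p ->
  exists b s M, [/\ 0 < s, 0 <= M & forall N, expands_to g p b s M N].
Proof.
move=> [b [r [r0 h]]]; pose s := r / 2; have s0 : 0 < s by rewrite divr_gt0.
have sr : s < r by rewrite /s; lra.
have := h (s, s); rewrite /= (gtr0_norm s0) => /(_ sr sr) [cs _].
exists b, s, (limn (pseries2 (fun i j => `|b i j|) (s, s))).
have nd : nondecreasing_seq (pseries2 (fun i j => `|b i j|) (s, s)).
  apply/nondecreasing_seqP => n; rewrite /pseries2 /series /= big_nat_recr //= lerDl.
  by apply: sumr_ge0 => i _; rewrite !mulr_ge0 // exprn_ge0 // ltW.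
have hM N : psum2_abs b N s <= limn (pseries2 (fun i j => `|b i j|) (s, s)).
  by rewrite psum2_absE -(pseries2E _ (s, s)); exact: nondecreasing_cvgn_le.
split; first exact: s0.
  by apply: le_trans (hM 0%N); rewrite /psum2_abs big_ord0.
move=> N; split; first exact: hM.
move=> x y xs ys.
have [cv <-] := h (x, y) (le_lt_trans xs sr) (le_lt_trans ys sr).
have {}cv : cvgn (pseries2 b (x, y)).
  apply: normed_cvg; apply: series_le_cvg cv => n //=.
    by apply: sumr_ge0 => i _; rewrite !mulr_ge0 // exprn_ge0.
  apply: le_trans (ler_norm_sum _ _ _) _; apply: ler_sum => i _.
  by rewrite !normrM !normrX.
apply: (@lim_dist_le _ _ _ N) => // K NK; rewrite pseries2E /=.
exact: psum2_diff_le.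
Qed.

Lemma expands_analytic_at2 (g : R * R -> R) (p : R * R) b s M :
  0 < s -> 0 <= M -> (forall N, expands_to g p b s M N) -> analytic_at2 g p.
Proof.
move=> s0 M0 h; exists b, s; split=> // v v1 v2.
have cv : cvgn (pseries2 (fun i j => `|b i j|) (`|v.1|, `|v.2|)).
  apply: nondecreasing_is_cvgn.
    apply/nondecreasing_seqP => n; rewrite /pseries2 /series /= big_nat_recr //= lerDl.
    by apply: sumr_ge0 => i _; rewrite !mulr_ge0 // exprn_ge0.
  exists M => _ [N _ <-]; have [hM _] := h N; apply: le_trans hM.
  rewrite pseries2E psum2_absE; apply: ler_sum => n _; apply: ler_sum => i _ /=.
  apply: ler_pM; rewrite ?mulr_ge0 ?exprn_ge0 //.
    rewrite ler_wpM2l //; apply: lerXn2r; rewrite ?nnegrE //; exact: ltW.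
  by apply: lerXn2r; rewrite ?nnegrE //; exact: ltW.
split=> //; apply/cvg_lim => //.
set m := Num.max `|v.1| `|v.2| / s.
have m0 : 0 <= m by rewrite divr_ge0 ?(ltW s0) // le_max normr_ge0.
have m1 : m < 1 by rewrite ltr_pdivrMr // mul1r gt_max v1 v2.
have cm : (fun n => M * m ^+ n) @ \oo --> 0.
  rewrite -(mulr0 M); apply: cvgMr.
  by apply: cvg_expr; rewrite ger0_norm.
apply/cvgrPdist_le => e e0.
have /cvgrPdist_le /(_ e e0) := cm.
apply: filterS => N; rewrite sub0r normrN pseries2E => hN.
have [_ /(_ v.1 v.2 (ltW v1) (ltW v2)) hN'] := h N.
by apply: le_trans hN' _; apply: le_trans hN; exact: ler_norm.
Qed.

End Expansions.

(** * The identity theorem on an interval *)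

Section Identity.
Variable R : realType.
Implicit Types (D J : set R) (r M t : R) (H : R -> R) (N : nat).

(** Jets of all orders with one radius and one bound: near 0, H is
the restriction to D of an analytic function. *)
Definition ujet D H := exists r M, [/\ 0 < r, 0 <= M &
  forall N, exists p, jet D r N H p M].

(** Flatness on D' kills the coefficients below every order N, so
|H t| <= M (|t| / r)^N for all N. *)
Lemma ujet_flat_eq0 D D' H : ujet D H -> D' `<=` D -> accum0 D' ->
  (forall N, exists C rho, 0 < rho /\
     forall t, D' t -> 0 < `|t| <= rho -> `|H t| <= C * `|t| ^+ N) ->
  exists r, 0 < r /\ forall t, D t -> `|t| < r -> H t = 0.
Proof.
move=> [r [M [r0 M0 hj]]] DD aD flat; exists r; split=> // t Dt tr.
have le N : `|H t| <= M * (`|t| / r) ^+ N.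
  have [p [e [e0 he h]]] := hj N; have [C [rho [rho0 hC]]] := flat N.
  have m0 : 0 < Num.min rho r by rewrite lt_min rho0.
  have p0 : forall n, (n < N)%N -> p`_n = 0.
    apply: (@flat_poly_coef0 _ _ _ (C + e / r ^+ N) _ _ aD m0) => t' Dt'.
    rewrite le_min => /and3P[t0 t1 t2].
    rewrite -(subKr (H t') p.[t']); apply: le_trans (ler_normB _ _) _.
    rewrite mulrDl; apply: lerD; first by apply: hC => //; rewrite t0.
    apply: le_trans (h _ (DD _ Dt') t2) _.
    by rewrite expr_div_n [leRHS]mulrAC mulrA.
  apply: (@le_trans _ _ ((wnorm r p + e) * (`|t| / r) ^+ N)); last first.
    by rewrite ler_wpM2r // exprn_ge0 // divr_ge0 // ltW.
  rewrite mulrDl -(subrK p.[t] (H t)) addrC.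
  apply: le_trans (ler_normD _ _) (lerD _ _).
    by apply: horner_norm_flat => //; exact: ltW.
  by apply: h => //; exact: ltW.
have c0 : (fun N => M * (`|t| / r) ^+ N) @ \oo --> 0.
  rewrite -(mulr0 M); apply: cvgMr; apply: cvg_expr.
  by rewrite ger0_norm ?divr_ge0 ?(ltW r0) // ltr_pdivrMr // mul1r.
apply/eqP; rewrite -normr_le0 -(cvg_lim _ c0) //.
apply: limr_ge; first by apply/cvg_ex; exists 0.
by apply: nearW => N; exact: le.
Qed.

Lemma interval_scale J (u t : R) : is_interval J -> J 0 -> J t -> 0 <= u <= 1 ->
  J (u * t).
Proof.
move=> iJ J0 Jt /andP[u0 u1]; have [t0|t0] := leP 0 t.
  by apply: (iJ 0 t) => //; rewrite mulr_ge0 //= ler_piMl.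
apply: (iJ t 0) => //; rewrite mulr_ge0_le0 ?andbT //; last exact: ltW.
nra.
Qed.

(** Connectedness argument along the segment from 0 to t: the supremum of
the parameters up to which H vanishes cannot be smaller than 1, since H is flat
there. *)
Lemma ujet_identity J H : is_interval J -> J 0 -> accum0 J ->
  (forall t0, J t0 -> ujet [set t | J (t0 + t)] (fun t => H (t0 + t))) ->
  (forall N, exists C rho, 0 < rho /\
     forall t, J t -> 0 < `|t| <= rho -> `|H t| <= C * `|t| ^+ N) ->
  forall t, J t -> H t = 0.
Proof.
move=> iJ J0 aJ uJ flat t1 Jt1.
have [t10|t10] := eqVneq t1 0.
  have u0 := uJ 0 J0.
  have [||N|r [r0 h]] := ujet_flat_eq0 (D' := J) u0.
  - by move=> t Jt /=; rewrite add0r.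
  - exact: aJ.
  - have [C [rho [rho0 h]]] := flat N; exists C, rho; split=> // t.
    by rewrite add0r; exact: h.
  have := h 0; rewrite /= addr0 normr0 t10; exact.
have nt1 : 0 < `|t1| by rewrite normr_gt0.
have JJ u : 0 <= u <= 1 -> J (u * t1) by exact: interval_scale.
pose S := [set s | 0 <= s <= 1 /\ forall u, 0 <= u <= s -> H (u * t1) = 0].
(* H vanishes around a parameter s as soon as it vanishes before s *)
have prop s : 0 <= s <= 1 -> (forall u, 0 <= u < s -> H (u * t1) = 0) ->
    exists r, 0 < r /\ forall u, 0 <= u <= 1 -> `|u - s| < r -> H (u * t1) = 0.
  move=> s01 hs; have Js := JJ s s01.
  suff [r [r0 h]] : exists r, 0 < r /\
      forall t, J (s * t1 + t) -> `|t| < r -> H (s * t1 + t) = 0.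
    exists (r / `|t1|); split; first exact: divr_gt0.
    move=> u u01; rewrite ltr_pdivlMr // -normrM mulrBl => ur.
    by have := h (u * t1 - s * t1); rewrite addrC subrK; apply => //; exact: JJ.
  have [s0|s0] := eqVneq s 0.
    rewrite s0 mul0r.
    have [||N|r [r0 h]] := ujet_flat_eq0 (D' := J) (uJ 0 J0).
    - by move=> t Jt /=; rewrite add0r.
    - exact: aJ.
    - have [C [rho [rho0 h]]] := flat N; exists C, rho; split=> // t.
      by rewrite add0r; exact: h.
    by exists r.
  have sp : 0 < s by rewrite lt_def s0; case/andP: s01.
  pose D' := [set t | J (s * t1 + t) /\ H (s * t1 + t) = 0].
  have [||N|r [r0 h]] := ujet_flat_eq0 (D' := D') (uJ _ Js).
  - by move=> t [].
  - move=> eps eps0.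
    pose d := Num.min s (eps / (2 * `|t1|)).
    have d0 : 0 < d by rewrite lt_min sp divr_gt0 // mulr_gt0.
    have ds : d <= s by rewrite ge_min lexx.
    have de : d * `|t1| < eps.
      apply: (@le_lt_trans _ _ (eps / 2)); last lra.
      rewrite -ler_pdivlMr // -mulrA -invfM; by rewrite ge_min lexx orbT.
    have E : s * t1 - d * t1 = (s - d) * t1 by ring.
    exists (- (d * t1)); rewrite normrN normrM (gtr0_norm d0) de mulr_gt0 //.
    split=> //; split => /=; rewrite E.
      by apply: JJ; lra.
    by apply: hs; lra.
  - exists 0, 1; split=> // t [_ ->] _; by rewrite normr0 mul0r.
  by exists r.
have S0 : S 0.
  split; first by rewrite lexx ler01.
  move=> u u0.
  have [r [r0 h]] : exists r, 0 < r /\ forall u, 0 <= u <= 1 -> `|u - 0| < r -> H (u * t1) = 0.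
    apply: prop; first by rewrite lexx ler01.
    move=> v; lra.
  apply: h; first lra.
  have -> : u = 0 by lra.
  by rewrite subrr normr0.
have hS : has_sup S.
  by split; [exists 0|exists 1 => s [/andP[]]].
pose s := sup S.
have s0 : 0 <= s by exact: sup_upper_bound.
have s1 : s <= 1 by apply: ge_sup; [exists 0|move=> x [/andP[]]].
have hs u : 0 <= u < s -> H (u * t1) = 0.
  move=> /andP[u0 us].
  have /(sup_adherent) /(_ hS) : 0 < s - u by rewrite subr_gt0.
  move=> [x [_ hx]]; rewrite -/s subKr => ux.
  by apply: hx; rewrite u0 ltW.
have [|r [r0 hr]] := prop s _ hs; first by rewrite s0.
pose s' := Num.min 1 (s + r / 2).
have s'1 : s' <= 1 by rewrite ge_min lexx.
have s'r : s' <= s + r / 2 by rewrite ge_min lexx orbT.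
have s'0 : 0 <= s' by rewrite le_min ler01 /= addr_ge0 // ltW // divr_gt0.
have hs' u : 0 <= u <= s' -> H (u * t1) = 0.
  move=> /andP[u0 us']; have [us|su] := ltP u s; first by apply: hs; rewrite u0.
  apply: hr; first by rewrite u0 (le_trans us').
  rewrite ger0_norm ?subr_ge0 //; lra.
have Ss' : S s' by split=> //; rewrite s'0.
have := sup_upper_bound hS Ss'; rewrite -/s => s's.
have e : s' = 1.
  move: s's; rewrite /s' /Num.min /Order.min; case: ifP => //; lra.
have := hs' 1; rewrite e mul1r; apply; by rewrite ler01 lexx.
Qed.

End Identity.

(** * Expansion of a double power series at nearby points *)

Section Recentering.
Variable R : realType.
Implicit Types (b : nat -> nat -> R) (K N : nat) (s M x y : R).

Lemma cvg_sum_ord n (F : nat -> nat -> R) (l : nat -> R) :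
  (forall i, (i < n)%N -> F i @ \oo --> l i) ->
  (fun K => \sum_(i < n) F i K) @ \oo --> \sum_(i < n) l i.
Proof.
elim: n => [|n IH] h.
  rewrite big_ord0.
  under eq_cvg do rewrite big_ord0.
  exact: cvg_cst.
rewrite big_ord_recr /=.
under eq_cvg do rewrite big_ord_recr /=.
apply: cvgD; last exact: h.
by apply: IH => i ni; apply: h; rewrite ltnS ltnW.
Qed.

Definition recenter_term b (p : R * R) i j n : R :=
  \sum_(k < n.+1) b k (n - k)%N * (p.1 ^+ (k - i) *+ 'C(k, i)) *
     (p.2 ^+ (n - k - j) *+ 'C(n - k, j)).

(** The coefficient of u^i v^j in the partial sum of order K of the series at
p + (u, v). *)
Definition recenter b p K i j : R := \sum_(n < K) recenter_term b p i j n.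

(** Used with the auxiliary variable that grades (u, v) by total degree, so
that expanding a product of two powers yields the triangular sums of psum2. *)
Lemma coef_affine_exp (a x : R) k i :
  ((a%:P + x *: 'X) ^+ k)`_i = a ^+ (k - i) *+ 'C(k, i) * x ^+ i.
Proof.
rewrite exprDn coef_sum; have [ik|ki] := leqP i k; last first.
  rewrite bin_small // mulr0n mul0r big1 // => j _.
  rewrite coefMn exprZn -rmorphXn /= mul_polyC !coefZ coefXn.
  case: eqP => [e|_]; last by rewrite !mulr0 mul0rn.
  by have := ltn_ord j; rewrite -e ltnS leqNgt ki.
rewrite (bigD1 (Ordinal (ik : (i < k.+1)%N))) //= big1 => [|j ji].
  rewrite addr0 coefMn exprZn -rmorphXn /= mul_polyC !coefZ coefXn eqxx mulr1.
  by rewrite mulrnAl.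
rewrite coefMn exprZn -rmorphXn /= mul_polyC !coefZ coefXn.
case: eqP => [e|_]; last by rewrite !mulr0 mul0rn.
by case/eqP: ji; apply: val_inj.
Qed.

Lemma psum2_recenter b (p : R * R) K x y :
  psum2 b K (p.1 + x) (p.2 + y) = psum2 (recenter b p K) K x y.
Proof.
pose P := psum2_poly b K (p.1%:P + x *: 'X) (p.2%:P + y *: 'X).
have sA (a z : R) k : (size ((a%:P + z *: 'X) ^+ k) <= k.+1)%N.
  apply: leq_trans (size_poly_exp_leq _ _) _.
  rewrite ltnS -[leqRHS]mul1n leq_mul2r; apply/orP; right.
  have : (size (a%:P + z *: 'X)%R <= 2)%N.
    apply: leq_trans (size_polyD _ _) _; rewrite geq_max.
    rewrite (leq_trans (size_polyC_leq1 _)) //.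
    by rewrite (leq_trans (size_scale_leq _ _)) // size_polyX.
  by case: (size _) => [|[|[|]]].
have sP : (size P <= K)%N.
  apply: leq_trans (size_sum _ _ _) _; apply/bigmax_leqP => n _.
  apply: leq_trans (size_sum _ _ _) _; apply/bigmax_leqP => i _.
  apply: leq_trans (size_scale_leq _ _) _.
  apply: leq_trans (size_polyMleq _ _) _.
  have := leq_add (sA p.1 x i) (sA p.2 y (n - i)%N).
  rewrite addSn addnS subnKC; last by rewrite -ltnS.
  have := ltn_ord n; move: (size _) (size _) => u v h1 h2.
  move: h1 h2; lia.
have <- : P.[1] = psum2 b K (p.1 + x) (p.2 + y).
  rewrite /P /psum2_poly horner_sum; apply: eq_bigr => n _.
  rewrite horner_sum; apply: eq_bigr => i _.
  by rewrite !hornerE.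
rewrite (horner_coef_wide _ sP); apply: eq_bigr => m _.
rewrite expr1n mulr1 /P /psum2_poly coef_sum.
under eq_bigr do rewrite coef_sum.
rewrite /recenter /recenter_term.
under [RHS]eq_bigr do rewrite mulr_suml mulr_suml.
rewrite exchange_big; apply: eq_bigr => n _ /=.
under [RHS]eq_bigr do rewrite mulr_suml mulr_suml.
rewrite exchange_big; apply: eq_bigr => k _ /=.
rewrite coefZ coefM mulr_sumr; apply: eq_bigr => i _.
rewrite !coef_affine_exp; ring.
Qed.

Lemma recenter_abs_le b (p : R * R) K i j :
  `|recenter b p K i j| <=
  recenter (fun i j => `|b i j|) (`|p.1|, `|p.2|) K i j.
Proof.
apply: le_trans (ler_norm_sum _ _ _) _; apply: ler_sum => n _.
apply: le_trans (ler_norm_sum _ _ _) _; apply: ler_sum => k _.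
by rewrite !normrM !normrMn !normrX.
Qed.

Lemma recenter_ge0 b (p : R * R) i j n : (forall i j, 0 <= b i j) ->
  0 <= p.1 -> 0 <= p.2 -> 0 <= recenter_term b p i j n.
Proof.
move=> b0 p1 p2; apply: sumr_ge0 => k _.
by rewrite !mulr_ge0 // mulrn_wge0 // exprn_ge0.
Qed.

Lemma le_psum2 b K x y x' y' : (forall i j, 0 <= b i j) -> 0 <= x <= x' ->
  0 <= y <= y' -> psum2 b K x y <= psum2 b K x' y'.
Proof.
move=> b0 /andP[x0 xx] /andP[y0 yy]; apply: ler_sum => n _; apply: ler_sum => i _.
have x'0 := le_trans x0 xx; have y'0 := le_trans y0 yy.
apply: ler_pM; rewrite ?mulr_ge0 ?exprn_ge0 //.
  by rewrite ler_wpM2l // lerXn2r.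
by rewrite lerXn2r.
Qed.

(** The recentered coefficients are dominated by those of the series of
absolute values recentered at (|p.1|, |p.2|), which sums at (s', s') to the value
of that series at |p| + s'. *)
Lemma psum2_abs_recenter_le b (p : R * R) K s (s' : R) : 0 <= s' ->
  `|p.1| + s' <= s -> `|p.2| + s' <= s ->
  psum2_abs (recenter b p K) K s' <= psum2_abs b K s.
Proof.
move=> s0 h1 h2; rewrite !psum2_absE.
apply: (@le_trans _ _ (psum2 (fun i j => `|b i j|) K (`|p.1| + s') (`|p.2| + s'))).
  rewrite (psum2_recenter _ (`|p.1|, `|p.2|)).
  apply: ler_sum => n _; apply: ler_sum => i _.
  by rewrite !ler_wpM2r ?exprn_ge0 // recenter_abs_le.
by apply: le_psum2 => //; rewrite addr_ge0.
Qed.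

Lemma le_psum2_abs b N K s : 0 <= s -> (N <= K)%N -> psum2_abs b N s <= psum2_abs b K s.
Proof.
move=> s0 NK; rewrite /psum2_abs.
rewrite (big_ord_widen _ (fun n => \sum_(i < n.+1) `|b i (n - i)%N| * s ^+ n) NK).
rewrite big_mkcond; apply: ler_sum => n _; case: ifP => // _.
by apply: sumr_ge0 => i _; rewrite mulr_ge0 // exprn_ge0.
Qed.

Lemma coef_le_psum2_abs b K s i j : 0 <= s -> (i + j < K)%N ->
  `|b i j| * s ^+ (i + j) <= psum2_abs b K s.
Proof.
move=> s0 ijK; rewrite /psum2_abs (bigD1 (Ordinal ijK)) //=.
have ii : (i < (i + j).+1)%N by rewrite ltnS leq_addr.
rewrite (bigD1 (Ordinal ii)) //= addKn -addrA lerDl.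
apply: addr_ge0; apply: sumr_ge0 => n _.
  by rewrite mulr_ge0 // exprn_ge0.
by apply: sumr_ge0 => k _; rewrite mulr_ge0 // exprn_ge0.
Qed.

Lemma recenter_cvg b (p : R * R) s (s' : R) M i j : 0 < s' ->
  `|p.1| + s' <= s -> `|p.2| + s' <= s -> (forall K, psum2_abs b K s <= M) ->
  cvgn (fun K => recenter b p K i j).
Proof.
move=> s0 h1 h2 hM.
have -> : (fun K => recenter b p K i j) = series (recenter_term b p i j).
  by apply/funext => K; rewrite /series /= big_mkord.
apply: normed_cvg.
pose b' := fun i j => `|b i j|; pose p' := (`|p.1|, `|p.2|).
have ge n : 0 <= recenter_term b' p' i j n.
  by apply: recenter_ge0 => [? ?||]; exact: normr_ge0.
apply: (@series_le_cvg _ _ (recenter_term b' p' i j)) => //.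
- by move=> n; exact: normr_ge0.
- move=> n; apply: le_trans (ler_norm_sum _ _ _) _; apply: ler_sum => k _.
  by rewrite !normrM !normrMn !normrX.
apply: nondecreasing_is_cvgn.
  by apply: nondecreasing_series => n _ _; exact: ge.
exists (M / s' ^+ (i + j)) => _ [N _ <-].
rewrite ler_pdivlMr ?exprn_gt0 // /series /= big_mkord -/(recenter b' p' N i j).
pose K := maxn N (i + j).+1.
have le1 : recenter b' p' N i j <= `|recenter b' p' K i j|.
  rewrite ger0_norm; last first.
    by apply: sumr_ge0 => n _; exact: ge.
  rewrite /recenter (big_ord_widen _ (recenter_term b' p' i j) (leq_maxl N (i + j).+1)).
  rewrite big_mkcond; apply: ler_sum => n _; case: ifP => // _.
apply: (@le_trans _ _ (`|recenter b' p' K i j| * s' ^+ (i + j))).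
  by rewrite ler_wpM2r // exprn_ge0 // ltW.
apply: le_trans (@coef_le_psum2_abs _ K _ _ _ (ltW s0) _) _.
  exact: leq_maxr.
have := @psum2_abs_recenter_le b' p' K s s' (ltW s0).
rewrite /p' /= !normr_id => /(_ h1 h2) h; apply: le_trans h _.
apply: le_trans (hM K); rewrite le_eqVlt; apply/orP; left; apply/eqP.
by apply: eq_bigr => n _; apply: eq_bigr => k _; rewrite /b' normr_id.
Qed.

(** The coefficients at p are the limits of those of the partial sums. The
bounds for partial sums are uniform, hence pass to the limit. *)
Lemma expands_recenter b s M (F : R * R -> R) (p : R * R) : 0 < s ->
  (forall K, psum2_abs b K s <= M) ->
  (forall x y, `|x| <= s -> `|y| <= s ->
     (fun K => psum2 b K x y) @ \oo --> F (x, y)) ->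
  `|p.1| <= s / 2 -> `|p.2| <= s / 2 ->
  exists d, forall N, expands_to F p d (s / 2) M N.
Proof.
move=> s0 hM hF p1 p2; pose s' := s / 2.
have s'0 : 0 < s' by rewrite divr_gt0.
have h1 : `|p.1| + s' <= s by rewrite /s'; lra.
have h2 : `|p.2| + s' <= s by rewrite /s'; lra.
pose d i j := limn (fun K => recenter b p K i j).
have cd i j : (fun K => recenter b p K i j) @ \oo --> d i j.
  by apply: (@recenter_cvg b p s s' M).
have hK K : psum2_abs (recenter b p K) K s' <= M.
  exact: le_trans (psum2_abs_recenter_le _ _ (ltW s'0) h1 h2) (hM K).
exists d => N; split.
  have c : (fun K => psum2_abs (recenter b p K) N s') @ \oo --> psum2_abs d N s'.
    apply: (@cvg_sum_ord N (fun n K => \sum_(i < n.+1) `|recenter b p K i (n - i)%N| * s' ^+ n)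
             (fun n => \sum_(i < n.+1) `|d i (n - i)%N| * s' ^+ n)) => n _.
    apply: (@cvg_sum_ord _ (fun i K => `|recenter b p K i (n - i)%N| * s' ^+ n)
             (fun i => `|d i (n - i)%N| * s' ^+ n)) => i _.
    by apply: cvgMl; apply: cvg_norm.
  rewrite -(cvg_lim _ c) //; apply: limr_le; first by apply/cvg_ex; eexists; exact: c.
  by exists N => // K /= NK; apply: le_trans (hK K); apply: le_psum2_abs => //; exact: ltW.
move=> x y xs ys; set m := Num.max _ _.
have c1 : (fun K => psum2 (recenter b p K) N x y) @ \oo --> psum2 d N x y.
  apply: (@cvg_sum_ord N (fun n K => \sum_(i < n.+1)
                recenter b p K i (n - i)%N * x ^+ i * y ^+ (n - i))
             (fun n => \sum_(i < n.+1) d i (n - i)%N * x ^+ i * y ^+ (n - i))) => n _.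
  apply: (@cvg_sum_ord _ (fun i K => recenter b p K i (n - i)%N * x ^+ i * y ^+ (n - i))
             (fun i => d i (n - i)%N * x ^+ i * y ^+ (n - i))) => i _.
  by apply: cvgMl; apply: cvgMl.
have c2 : (fun K => psum2 b K (p.1 + x) (p.2 + y)) @ \oo --> F (p.1 + x, p.2 + y).
  apply: hF.
    by apply: le_trans h1; apply: le_trans (ler_normD _ _) _; rewrite lerD2l.
  by apply: le_trans h2; apply: le_trans (ler_normD _ _) _; rewrite lerD2l.
have c3 : (fun K => `|psum2 b K (p.1 + x) (p.2 + y) - psum2 (recenter b p K) N x y|)
    @ \oo --> `|F (p.1 + x, p.2 + y) - psum2 d N x y|.
  by apply: cvg_norm; apply: cvgB.
rewrite -(cvg_lim _ c3) //; apply: limr_le; first by apply/cvg_ex; eexists; exact: c3.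
exists N => // K /= NK; rewrite psum2_recenter.
exact: psum2_diff_le.
Qed.

Lemma psum2_cvg b s M x y : 0 < s -> (forall K, psum2_abs b K s <= M) ->
  `|x| <= s -> `|y| <= s -> cvgn (fun K => psum2 b K x y).
Proof.
move=> s0 hM xs ys.
have -> : (fun K => psum2 b K x y) = pseries2 b (x, y).
  by apply/funext => K; rewrite pseries2E.
apply: normed_cvg; apply: nondecreasing_is_cvgn.
  by apply: nondecreasing_series => n _ _; exact: normr_ge0.
exists M => _ [N _ <-]; apply: le_trans (hM N); rewrite /normed_series_of seriesEord /=.
apply: ler_sum => n _; apply: le_trans (ler_norm_sum _ _ _) _.
apply: ler_sum => i _; rewrite !normrM !normrX -mulrA ler_wpM2l //.
have -> : s ^+ n = s ^+ i * s ^+ (n - i) by rewrite -exprD subnKC // -ltnS.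
by apply: ler_pM; rewrite ?exprn_ge0 // lerXn2r // nnegrE // ltW.
Qed.

(** There are n + 1 <= 2^n terms of order n, each at most L 4^-n at this
radius. *)
Lemma psum2_abs_geo_le b (L : R) N : 0 < L ->
  (forall i j, `|b i j| <= L ^+ (i + j).+1) -> psum2_abs b N (4 * L)^-1 <= 2 * L.
Proof.
move=> L0 hb.
apply: (@le_trans _ _ (\sum_(0 <= n < N) L * 2^-1 ^+ n)); last first.
  rewrite -mulr_sumr mulrC ler_wpM2r ?(ltW L0) //.
  by have := @sum_geo_le R 2^-1 0 N; rewrite expr0 mulr1; apply; rewrite lexx invr_ge0 ler0n.
rewrite big_mkord; apply: ler_sum => n _.
apply: (@le_trans _ _ (\sum_(i < n.+1) L * 4^-1 ^+ n)).
  apply: ler_sum => i _; have := hb i (n - i)%N.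
  rewrite subnKC; last by rewrite -ltnS.
  move=> h; apply: le_trans (ler_wpM2r _ h) _.
    by rewrite exprn_ge0 // invr_ge0 mulr_ge0 // ltW.
  rewrite exprS -mulrA -exprMn ler_wpM2l ?(ltW L0) //.
  suff -> : L * (4 * L)^-1 = 4^-1 by [].
  by field; rewrite gt_eqF.
rewrite sumr_const card_ord -[leLHS]mulr_natl mulrCA ler_wpM2l ?(ltW L0) //.
have -> : (4^-1 : R) = 2^-1 * 2^-1 by lra.
rewrite exprMn mulrA ler_piMl ?exprn_ge0 ?invr_ge0 //.
rewrite exprVn ler_pdivrMr ?exprn_gt0 // mul1r -natrX ler_nat.
exact: ltn_expl.
Qed.

End Recentering.

(** * Taylor formula in two variables *)

Section Taylor.
Variable R : realType.
Implicit Types (g : R * R -> R) (N : nat) (x y C rho : R).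

Fixpoint tcoef_x i g : R :=
  if i is i'.+1 then tcoef_x i' ('D_(1 : R, 0 : R) g) / i%:R else g (0, 0).

Fixpoint tcoef_y j i g : R :=
  if j is j'.+1 then tcoef_y j' i ('D_(0 : R, 1 : R) g) / j%:R else tcoef_x i g.

(** The mixed derivatives divided by factorials, taken in a fixed order, y
before x, which is the order produced by the induction in taylor2. *)
Definition tcoef g i j : R := tcoef_y j i g.

Lemma is_derive_x g x y : derivable g (x, y) (1 : R, 0 : R) ->
  is_derive x 1 (fun s => g (s, y)) ('D_(1 : R, 0 : R) g (x, y)).
Proof.
have E : (fun h : R => h^-1 *: (((fun s => g (s, y)) \o shift x) (h *: (1 : R)) - g (x, y))) =
  (fun h : R => h^-1 *: ((g \o shift (x, y)) (h *: (1 : R, 0 : R)) - g (x, y))).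
  apply/funext => h /=; congr (_ *: (g _ - _)).
  by congr pair; rewrite /= scaler0 add0r.
by move=> dg; apply: DeriveDef; rewrite /derivable /derive E.
Qed.

Lemma is_derive_y g x y : derivable g (x, y) (0 : R, 1 : R) ->
  is_derive y 1 (fun s => g (x, s)) ('D_(0 : R, 1 : R) g (x, y)).
Proof.
have E : (fun h : R => h^-1 *: (((fun s => g (x, s)) \o shift y) (h *: (1 : R)) - g (x, y))) =
  (fun h : R => h^-1 *: ((g \o shift (x, y)) (h *: (0 : R, 1 : R)) - g (x, y))).
  apply/funext => h /=; congr (_ *: (g _ - _)).
  by congr pair; rewrite /= scaler0 add0r.
by move=> dg; apply: DeriveDef; rewrite /derivable /derive E.
Qed.

Lemma is_derive_dist_le (h dh : R -> R) (a B : R) :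
  (forall s : R, `|s| <= `|a| -> is_derive s 1 h (dh s) /\ `|dh s| <= B) ->
  `|h a - h 0| <= B * `|a|.
Proof.
move=> H.
have mvt u v : u <= v -> (forall s, u <= s <= v -> `|s| <= `|a|) ->
    exists2 c, u <= c <= v & h v - h u = dh c * (v - u).
  move=> uv huv.
  have [||c] := @MVT_segment R h dh u v uv.
  - move=> s; rewrite in_itv /= => /andP[us sv].
    by have [] := H s; first by apply: huv; rewrite !ltW.
  - apply: derivable_within_continuous => s; rewrite in_itv /= => us.
    by have [[]] := H s (huv s us).
  - by rewrite in_itv /=; exists c.
have [a0|a0] := leP 0 a.
  have [|c /andP[c0 ca] ->] := mvt 0 a a0.
    by move=> s /andP[s0 sa]; rewrite !ger0_norm.
  rewrite subr0 normrM ler_wpM2r //; have [] // := H c.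
  by rewrite !ger0_norm.
have [|c /andP[c0 ca] E] := mvt a 0 (ltW a0).
  by move=> s /andP[s0 sa]; rewrite !ler0_norm ?lerN2 // ltW.
rewrite distrC E sub0r normrM normrN ler_wpM2r //; have [] // := H c.
by rewrite !ler0_norm ?lerN2 // ltW.
Qed.

Lemma psum2_y0 (b : nat -> nat -> R) N x :
  psum2 b N x 0 = (\sum_(n < N) b n 0%N *: 'X^n).[x].
Proof.
rewrite horner_sum; apply: eq_bigr => n _.
rewrite big_ord_recr /= subnn expr0 mulr1 big1 ?add0r ?hornerE ?hornerXn //.
move=> i _; have : (0 < n - i)%N by rewrite subn_gt0.
by case: (n - i)%N => // k _; rewrite exprS mul0r mulr0.
Qed.

Definition ypoly (b : nat -> nat -> R) N x : {poly R} :=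
  \sum_(n < N) \sum_(i < n.+1) (b i (n - i)%N * x ^+ i) *: 'X^(n - i).

Lemma psum2_ypoly b N x y : psum2 b N x y = (ypoly b N x).[y].
Proof.
rewrite horner_sum; apply: eq_bigr => n _.
by rewrite horner_sum; apply: eq_bigr => i _; rewrite !hornerE.
Qed.

Lemma deriv_ypoly g N x :
  (ypoly (tcoef g) N.+1 x)^`() = ypoly (tcoef ('D_(0 : R, 1 : R) g)) N x.
Proof.
rewrite /ypoly big_ord_recl big_ord1 subnn /= expr0 alg_polyC.
rewrite derivD derivC add0r raddf_sum /=; apply: eq_bigr => n _.
rewrite raddf_sum big_ord_recr /= subnn expr0 alg_polyC derivC addr0.
apply: eq_bigr => i _.
have -> : (bump 0 n - i = (n - i).+1)%N by exact: (subSn (ltn_ord i : (i <= n)%N)).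
rewrite derivZ derivXn /= -[X in _ *: X = _]scaler_nat scalerA mulrAC /tcoef /=.
by rewrite divfK // pnatr_eq0.
Qed.

Lemma deriv_xpoly g N :
  (\sum_(n < N.+1) tcoef g n 0%N *: 'X^n)^`() =
  \sum_(n < N) tcoef ('D_(1 : R, 0 : R) g) n 0%N *: 'X^n.
Proof.
rewrite big_ord_recl /= expr0 alg_polyC.
rewrite derivD derivC add0r raddf_sum /=; apply: eq_bigr => n _.
rewrite /bump leq0n add1n derivZ derivXn /= -[X in _ *: X = _]scaler_nat scalerA /tcoef /=.
by rewrite divfK // pnatr_eq0.
Qed.

(** Induction on N applied to the two partial derivatives, and integration
along the path (0, 0), (x, 0), (x, y) by the mean value theorem: the truncated
series has the truncated series of the derivatives as its derivatives along
this path. *)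
Lemma taylor2 (U : set (R * R)) g N : open U -> U (0, 0) -> Ck_on N U g ->
  exists C rho, [/\ 0 <= C, 0 < rho &
   forall x y, `|x| <= rho -> `|y| <= rho ->
     `|g (x, y) - psum2 (tcoef g) N x y| <= C * Num.max `|x| `|y| ^+ N].
Proof.
move=> oU U0.
have [rU [rU0 hU]] : exists r, 0 < r /\ forall x y, `|x| <= r -> `|y| <= r -> U (x, y).
  have /nbhs_ballP[e /= e0 he] := open_nbhs_nbhs (conj oU U0).
  exists (e / 2); split; first by rewrite divr_gt0.
  move=> x y xe ye; apply: he; rewrite /ball /= /prod_ball /=.
  by split; rewrite /ball /= sub0r normrN; lra.
elim: N g => [|N IH] g.
  move=> [cg _]; have /cvgrPdist_le /(_ 1 ltr01) := cg _ U0.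
  move=> /nbhs_ballP[e /= e0 he].
  exists (`|g (0, 0)| + 1), (e / 2); split; first by rewrite addr_ge0.
    by rewrite divr_gt0.
  move=> x y xe ye; rewrite /psum2 big_ord0 subr0 expr0 mulr1.
  have h : `|g (0, 0) - g (x, y)| <= 1.
    apply: (he (x, y)); rewrite /ball /= /prod_ball /=.
    by split; rewrite /ball /= sub0r normrN; lra.
  rewrite -(subKr (g (0, 0)) (g (x, y))).
  apply: le_trans (ler_normB _ _) _; by rewrite lerD2l.
move=> [cg [dg /IH [C1 [r1 [C10 r10 h1]]] /IH [C2 [r2 [C20 r20 h2]]]]].
pose r := Num.min rU (Num.min r1 r2).
have r0 : 0 < r by rewrite !lt_min rU0 r10 r20.
have lr u : u <= r -> [/\ u <= rU, u <= r1 & u <= r2].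
  by rewrite !le_min => /and3P[].
exists (C1 + C2), r; split; [exact: addr_ge0|by []|].
move=> x y xr yr; set m := Num.max _ _.
have xm : `|x| <= m by rewrite le_max lexx.
have ym : `|y| <= m by rewrite le_max lexx orbT.
have m0 : 0 <= m by rewrite le_max normr_ge0.
pose Px := \sum_(n < N.+1) tcoef g n 0%N *: 'X^n.
pose h s := g (s, 0) - Px.[s].
pose k s := g (x, s) - (ypoly (tcoef g) N.+1 x).[s].
have hb : `|h x - h 0| <= C1 * m ^+ N * `|x|.
  apply: (@is_derive_dist_le h (fun s => 'D_(1 : R, 0 : R) g (s, 0) - Px^`().[s])).
  move=> s sx; have [s1 s2 s3] := lr _ (le_trans sx xr); split.
    have Us : U (s, 0) by apply: hU => //; rewrite normr0 ltW.
    have [dx _] := dg _ Us.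
    by apply: is_deriveB; apply: is_derive_x; exact: dx.
  rewrite deriv_xpoly -psum2_y0; apply: le_trans (h1 _ _ s2 _) _.
    by rewrite normr0 ltW.
  rewrite ler_wpM2l //; apply: lerXn2r; rewrite ?nnegrE.
  - by rewrite le_max normr_ge0.
  - exact: m0.
  - by rewrite normr0 ge_max m0 andbT (le_trans sx).
have kb : `|k y - k 0| <= C2 * m ^+ N * `|y|.
  apply: (@is_derive_dist_le k
    (fun s => 'D_(0 : R, 1 : R) g (x, s) - (ypoly (tcoef g) N.+1 x)^`().[s])).
  move=> s sy; have [s1 s2 s3] := lr _ (le_trans sy yr).
  have [x1 x2 x3] := lr _ xr; split.
    have Us : U (x, s) by exact: hU.
    have [_ dy] := dg _ Us.
    by apply: is_deriveB; apply: is_derive_y; exact: dy.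
  rewrite deriv_ypoly -psum2_ypoly; apply: le_trans (h2 _ _ x3 s3) _.
  rewrite ler_wpM2l //; apply: lerXn2r; rewrite ?nnegrE.
  - by rewrite le_max normr_ge0.
  - exact: m0.
  - by rewrite ge_max xm (le_trans sy).
have h0 : h 0 = 0.
  rewrite /h /Px horner_sum big_ord_recl big1 => [|i _]; last first.
    by rewrite !hornerE expr0n mulr0.
  by rewrite /= !hornerE /tcoef /= subrr.
have kh : k 0 = h x.
  by rewrite /k /h -psum2_ypoly psum2_y0.
rewrite psum2_ypoly -/(k y) -(subrK (k 0) (k y)) kh.
rewrite h0 subr0 in hb; rewrite kh in kb.
apply: le_trans (ler_normD _ _) _.
rewrite exprSr mulrA mulrDl mulrDl addrC; apply: lerD.
  by apply: le_trans hb _; rewrite ler_wpM2l // mulr_ge0 // exprn_ge0.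
by apply: le_trans kb _; rewrite ler_wpM2l // mulr_ge0 // exprn_ge0.
Qed.

End Taylor.

(** * Logarithmic capacity and products of distances *)

Section Cap.
Variable R : realType.
Implicit Types (E : set R) (mu : probability (R * R)%type R).

(** The truncated kernel of the logarithmic potential on the real line. *)
Definition cut_log (N : nat) (a x : R) : R :=
  if x == a then N%:R else Num.min N%:R (- ln `|x - a|).

Lemma cut_logE N (a x : R) :
  mine (N%:R)%:E (- lne (cmod (a - x, 0 - 0))%:E)%E
  = (cut_log N a x)%:E.
Proof.
rewrite /cmod /= subrr expr0n addr0 sqrtr_sqr distrC /cut_log.
case: (eqVneq x a) => [->|xa].
  by rewrite subrr normr0 lexx /= /Order.min ltey.
have h : 0 < `|x - a| by rewrite normr_gt0 subr_eq0.
rewrite leNgt h /=. by rewrite EFin_min.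
Qed.

Lemma measurable_cut_log N (a : R) : measurable_fun setT (cut_log N a).
Proof.
apply: measurable_fun_ifT => //.
- exact: measurable_fun_eqr.
- apply: measurable_minr => //; apply: measurable_funN.
  apply: (measurableT_comp (f := @ln R)); first exact: measurable_ln.
  apply: (measurableT_comp (f := @Num.norm R R)) => //.
  exact: measurable_funB.
Qed.

(** Bounded below because |x - a| <= 8 + 12; adding ln 20 makes the kernel
nonnegative. *)
Lemma cut_log_ge N (a x : R) : `|a| <= 12 -> 0 <= x <= 2 * pi ->
  0 <= cut_log N a x + ln 20.
Proof.
move=> ha /andP[x0 x1].
have p4 : (pi : R) <= 4 by by have := @pihalf_lt2 R; lra.
have l0 : 0 <= ln (20 : R) by apply: ln_ge0; lra.
rewrite /cut_log; case: eqP => xa; first exact: addr_ge0.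
rewrite /Order.min; case: ifP => _; first exact: addr_ge0.
rewrite addrC subr_ge0 ler_ln ?posrE.
- by apply: le_trans (ler_normB _ _) _; rewrite (ger0_norm x0); lra.
- by rewrite normr_gt0 subr_eq0; apply/eqP.
- lra.
Qed.


Lemma real_axis_setE E : real_axis_set E = E `*` [set 0].
Proof.
apply/seteqP; split=> [_ [t Et <-]|[x y] [/= Ex ->]] //=.
by exists x.
Qed.

Lemma measurable_real_axis_set E : closed E -> measurable (real_axis_set E).
Proof.
move=> cE; rewrite real_axis_setE; apply: measurableX => //.
exact: closed_measurable.
Qed.

Lemma integrable_cut_log E mu N (a : R) : closed E ->
  E `<=` [set x : R | 0 <= x <= 2 * pi] -> `|a| <= 12 ->
  mu.-integrable (real_axis_set E) (fun p => (cut_log N a p.1)%:E).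
Proof.
move=> cE sE ha.
apply: (@measurable_bounded_integrable _ _ _ mu (fun p => cut_log N a p.1)).
- exact: measurable_real_axis_set.
- by rewrite (le_lt_trans (probability_le1 mu (measurable_real_axis_set cE))) // ltry.
- apply: measurable_funTS; apply: (measurableT_comp (measurable_cut_log N a)).
  exact: measurable_fst.
- exists (ln 20 + N%:R); split; first exact: num_real.
  move=> M hM _ [x Ex <-] /=; apply: le_trans (ltW hM).
  have l0 : 0 <= ln (20 : R) by apply: ln_ge0; lra.
  have := cut_log_ge N ha (sE _ Ex).
  have : cut_log N a x <= N%:R.
    by rewrite /cut_log; case: eqP => // _; rewrite ge_min lexx.
  have : 0 <= N%:R :> R by [].
  move: (cut_log N a x) (N%:R : R) => u v h1 h2 h3.
  by rewrite ler_norml; apply/andP; split; lra.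
Qed.

(** The potential is the supremum of the integrals of the truncated
kernels. *)
Lemma integral_cut_log_le E mu (V : \bar R) (N : nat) (a : R) : closed E ->
  E `<=` [set x : R | 0 <= x <= 2 * pi] -> `|a| <= 12 ->
  (log_potential (real_axis_set E) mu (a, 0%R) <= V)%E ->
  (\int[mu]_(p in real_axis_set E) (cut_log N a p.1)%:E <= V)%E.
Proof.
move=> cE sE ha; apply: le_trans.
have -> : log_potential (real_axis_set E) mu (a, 0%R) =
    limn (fun N => \int[mu]_(p in real_axis_set E) (cut_log N a p.1)%:E)%E.
  rewrite /log_potential; congr (limn _); apply/funext => n.
  apply: eq_integral => p /set_mem [x Ex <-] /=.
  exact: cut_logE.
have nd : nondecreasing_seq
    (fun N => \int[mu]_(p in real_axis_set E) (cut_log N a p.1)%:E)%E.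
  move=> n m nm; apply: le_integral.
  - exact: measurable_real_axis_set.
  - exact: integrable_cut_log.
  - exact: integrable_cut_log.
  move=> p _; rewrite lee_fin /cut_log; case: eqP => _.
    by rewrite ler_nat.
  by rewrite le_min ge_min ler_nat nm /= ge_min lexx orbT.
rewrite (cvg_lim _ (ereal_nondecreasing_cvgn nd)) //.
by apply: ereal_sup_ubound; exists N.
Qed.

Lemma capacity_pos_bound E : (0 < log_capacity (real_axis_set E))%E ->
  exists mu (V : R), mu (real_axis_set E) = 1%E /\
    forall z, (log_potential (real_axis_set E) mu z <= V%:E)%E.
Proof.
move=> cap.
have inf_lt : (ereal_inf
    [set ereal_sup (range (log_potential (real_axis_set E) mu)) |
       mu in [set mu : probability (R * R)%type R | mu (real_axis_set E) = 1]] < +oo)%E.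
  rewrite ltey; apply/eqP => e; move: cap; rewrite /log_capacity e /=.
  by rewrite ltxx.
have [_ [mu mu1 <-] lt] := ereal_inf_lt inf_lt.
exists mu.
have [V hV] : exists V : R, (ereal_sup (range (log_potential (real_axis_set E) mu)) <= V%:E)%E.
  case: (ereal_sup _) lt => [r| |] //= _; first by exists r.
  by exists 0; rewrite leNye.
exists V; split => // z; apply: le_trans hV.
by apply: ereal_sup_ubound; exists z.
Qed.

(** The sum of the kernels log 1/|x - a| over the points of s has a
mu-integral at most linear in the size of s. Adding a constant makes it
nonnegative, so the same holds for the integral over B, and some point of B does
not exceed the mean over B. Exponentiating gives the product. *)
Lemma capacity_product_ge E :
  closed E -> E `<=` [set x : R | 0 <= x <= 2 * pi] ->
  (0 < log_capacity (real_axis_set E))%E ->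
  exists mu, mu (real_axis_set E) = 1%E /\
  forall B, measurable B -> B `<=` real_axis_set E -> (0 < mu B)%E ->
  exists delta : R, 0 < delta /\
    forall s : seq R, (forall a, a \in s -> `|a| <= 12) ->
      exists x, B (x, 0) /\ delta ^+ size s <= \prod_(a <- s) `|x - a|.
Proof.
move=> cE sE /capacity_pos_bound [mu [V [mu1 hV]]].
exists mu; split=> // B mB BE muB.
set A := real_axis_set E in BE mu1 hV *.
have mA : measurable A by exact: measurable_real_axis_set.
pose L : R := ln 20.
have L0 : 0 <= L by apply: ln_ge0; lra.
have Bfin : mu B \is a fin_num by rewrite fin_num_measure.
pose b := fine (mu B).
have b0 : 0 < b by rewrite fine_gt0 // muB /= -ge0_fin_numE // measure_ge0.
have Eb : mu B = b%:E by rewrite fineK.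
(* D exceeds the mean over B of one nonnegative kernel *)
pose D := (`|V| + L + 1) / b.
have D0 : 0 < D by rewrite divr_gt0 // ltr_wpDl // addr_ge0.
exists (expR (- D)); split; first exact: expR_gt0.
move=> s hs.
have [-> | s0] := eqVneq s [::].
  have [p Bp] : B !=set0.
    by apply/set0P; apply/eqP => B0; move: muB; rewrite B0 measure0 ltxx.
  have [x Ex ep] := BE _ Bp; exists x; rewrite ep; split=> //.
  by rewrite /= big_nil expr0.
pose n := size s.
have n0 : 0 < n%:R :> R by rewrite ltr0n lt0n size_eq0.
(* a truncation level that is not reached where the sum is below n D *)
have [N hN] : exists N : nat, n%:R * D < N%:R.
  exists (Num.truncn (n%:R * D)).+1; exact: truncnS_gt.
pose g a (p : R * R) := cut_log N a p.1 + L.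
have g0 a p : a \in s -> A p -> 0 <= g a p.
  by move=> sa [x Ex <-]; apply: cut_log_ge => //; [exact: hs|exact: sE].
have mg a : measurable_fun setT (g a).
  apply: measurable_funD => //.
  apply: (measurableT_comp (measurable_cut_log N a)); exact: measurable_fst.
have ig a : a \in s -> (\int[mu]_(p in A) (g a p)%:E <= (V + L)%:E)%E.
  move=> sa.
  have -> : (\int[mu]_(p in A) (g a p)%:E =
     \int[mu]_(p in A) (cut_log N a p.1)%:E + \int[mu]_(p in A) (cst L%:E p))%E.
    rewrite -integralD //=.
    - apply: integrable_cut_log => //; exact: hs.
    - exact: finite_measure_integrable_cst.
  rewrite integral_cst // [X in (_ * X)%E]mu1 mule1 EFinD leeD2r //.
  apply: integral_cut_log_le => //; exact: hs.
have [[x y] [Bp hp]] : exists p, B p /\ \sum_(a <- s) g a p < n%:R * D.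
  apply: contrapT => /forallNP H.
  have : ((n%:R * D)%:E * mu B <= (n%:R * (V + L))%:E)%E.
    rewrite -integral_cst //.
    apply: (@le_trans _ _ (\int[mu]_(p in B) \sum_(a <- s) (Num.max 0 (g a p))%:E)%E).
      apply: ge0_le_integral => //.
      - by move=> p _; rewrite lee_fin mulr_ge0 // ltW.
      - apply: emeasurable_sum => a; apply: measurable_funTS.
        by apply/measurable_EFinP; apply: measurable_maxr.
      - move=> p Bp; rewrite sumEFin lee_fin.
        have := H p; rewrite not_andE => -[//|/negP]; rewrite -leNgt.
        move=> h; apply: le_trans h _; apply: ler_sum => a _.
        by rewrite le_max lexx orbT.
    apply: (@le_trans _ _ (\int[mu]_(p in A) \sum_(a <- s) (Num.max 0 (g a p))%:E)%E).
      apply: ge0_subset_integral => //.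
      + apply: emeasurable_sum => a; apply: measurable_funTS.
        by apply/measurable_EFinP; apply: measurable_maxr.
      + by move=> p _; rewrite sume_ge0 // => a _; rewrite lee_fin le_max lexx.
    rewrite ge0_integral_sum //; last first.
    - by move=> a p _; rewrite lee_fin le_max lexx.
    - move=> a; apply: measurable_funTS.
      by apply/measurable_EFinP; apply: measurable_maxr.
    have -> : (n%:R * (V + L))%:E = (\sum_(a <- s) (V + L)%:E)%E.
      by rewrite sumEFin big_const_seq count_predT iter_addr_0 mulr_natl.
    rewrite big_seq [leRHS]big_seq; apply: lee_sum => a sa.
    rewrite (le_trans _ (ig a sa)) // le_eqVlt; apply/orP; left; apply/eqP.
    apply: eq_integral => p /set_mem Ap; congr EFin.
    by apply/max_idPr; exact: g0.
  rewrite Eb -EFinM lee_fin -mulrA ler_pM2l // /D mulfVK ?gt_eqF //.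
  have := ler_norm V; lra.
have Ey : y = 0 by case: (BE _ Bp) => t _ /(congr1 snd).
rewrite {}Ey in Bp hp.
exists x; split => //.
have each a : a \in s -> 0 < `|x - a| /\ cut_log N a x = - ln `|x - a|.
  move=> sa.
  have le1 : g a (x, 0) <= \sum_(a <- s) g a (x, 0).
    rewrite (big_rem a) //= lerDl big_seq sumr_ge0 // => c /mem_rem sc.
    by apply: g0 => //; exact: BE.
  have : cut_log N a x < N%:R.
    apply: le_lt_trans (lt_trans (le_lt_trans le1 hp) hN).
    by rewrite /g /= lerDl.
  rewrite /cut_log; case: eqP => xa; first by rewrite ltxx.
  rewrite /Order.min; case: ifP => _; first by rewrite ltxx.
  by move=> _; rewrite normr_gt0 subr_eq0; split => //; apply/eqP.
have Eprod : \prod_(a <- s) `|x - a| = expR (- \sum_(a <- s) cut_log N a x).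
  rewrite -sumrN expR_sum big_seq [RHS]big_seq; apply: eq_bigr => a sa.
  by have [p0 ->] := each a sa; rewrite opprK lnK.
rewrite Eprod -expRM_natl ler_expR -/n mulrN lerN2.
apply: le_trans (ltW hp); apply: ler_sum => a _.
by rewrite /g /= lerDl.
Qed.

End Cap.

(** * Growth of polynomials on the unit circle *)

Section BernsteinWalsh.
Local Open Scope complex_scope.
Variable R : realType.
Local Notation C := R[i].
Implicit Types (z w : C) (x y : R).

Definition cabs z : R := complex.Re `|z|.

Lemma cabsE z : (cabs z)%:C = `|z|.
Proof. by rewrite /cabs normc_def. Qed.

Lemma cabs_ge0 z : 0 <= cabs z.
Proof. by rewrite -ler0c cabsE. Qed.

Lemma cabsM z w : cabs (z * w) = cabs z * cabs w.
Proof. by apply: complexI; rewrite rmorphM /= !cabsE normrM. Qed.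

Lemma cabsD z w : cabs (z + w) <= cabs z + cabs w.
Proof. by rewrite -lecR rmorphD /= !cabsE ler_normD. Qed.

Lemma cabsN z : cabs (- z) = cabs z.
Proof. by apply: complexI; rewrite !cabsE normrN. Qed.

Lemma cabs_prod (s : seq C) (F : C -> C) :
  cabs (\prod_(z <- s) F z) = \prod_(z <- s) cabs (F z).
Proof.
apply: complexI; rewrite cabsE normr_prod rmorph_prod.
by apply: eq_bigr => z _; rewrite /= cabsE.
Qed.

Lemma cabs_def (a b : R) : cabs (a +i* b) = Num.sqrt (a ^+ 2 + b ^+ 2).
Proof. by rewrite /cabs normc_def. Qed.

Lemma cabs_sqr (a b : R) : cabs (a +i* b) ^+ 2 = a ^+ 2 + b ^+ 2.
Proof. by rewrite cabs_def sqr_sqrtr // addr_ge0 // sqr_ge0. Qed.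

Lemma cabs_real (a : R) : cabs a%:C = `|a|.
Proof. by rewrite cabs_def expr0n addr0 sqrtr_sqr. Qed.

Definition cis x : C := cos x +i* sin x.

Lemma cabs_cis x : cabs (cis x) = 1.
Proof. by rewrite cabs_def cos2Dsin2 sqrtr1. Qed.

Lemma polar_form w : exists a, `|a| <= pi /\ w = (cabs w)%:C * cis a.
Proof.
case: w => u v; set w := u +i* v.
have [w0|w0] := eqVneq (cabs w) 0.
  exists 0; split; first by rewrite normr0 pi_ge0.
  have /eqP : `|w| = 0 by rewrite -cabsE w0.
  by rewrite w0 mul0r normr_eq0 => /eqP.
set r := cabs w in w0 *.
have r0 : 0 < r by rewrite lt_def w0 cabs_ge0.
have r2 : r ^+ 2 = u ^+ 2 + v ^+ 2 by exact: cabs_sqr.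
have ur : -1 <= u / r <= 1.
  rewrite ler_pdivrMr // ler_pdivlMr // mulN1r mul1r; apply/andP; split; nra.
have ca : cos (acos (u / r)) = u / r by apply: acosK; rewrite in_itv.
have sa : sin (acos (u / r)) = `|v| / r.
  rewrite sin_acos // -[RHS]ger0_norm ?divr_ge0 ?(ltW r0) // -sqrtr_sqr.
  congr Num.sqrt; rewrite !expr_div_n real_normK ?num_real // r2.
  have : u ^+ 2 + v ^+ 2 != 0 by rewrite -r2 expf_neq0.
  by move=> ?; field.
have a0 := acos_ge0 ur; have api := acos_lepi ur.
have E (s : R) : v = s * `|v| ->
   w = r%:C * (cos (acos (u / r)) +i* (s * sin (acos (u / r)))).
  move=> vs; rewrite ca sa /w; simpc; congr (_ +i* _); first by field.
  rewrite {1}vs; by field.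
have [v0|v0] := leP 0 v.
  exists (acos (u / r)); split; first by rewrite ger0_norm.
  rewrite /cis -[sin _]mul1r; apply: E; by rewrite mul1r ger0_norm.
exists (- acos (u / r)); split; first by rewrite normrN ger0_norm.
rewrite /cis cosN sinN -mulN1r; apply: E; by rewrite mulN1r ltr0_norm ?opprK.
Qed.

(** With v = x / 2, the mean value theorem gives sin v >= v cos v, so
sin x = 2 sin v cos v >= 2 v cos^2 v = v (1 + cos x) >= v. *)
Lemma sin_ge_half x : 0 <= x <= pi / 2 -> x / 2 <= sin x.
Proof.
move=> /andP[x0 xp].
have p4 : pi / 2 < 2 :> R := pihalf_lt2 R.
pose v := x / 2; have v0 : 0 <= v by rewrite divr_ge0.
have [|c] := @MVT_segment R sin cos 0 v v0.
  by apply: derivable_within_continuous => s _; exact: derivable_sin.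
rewrite in_itv /= sin0 !subr0 => /andP[c0 cv] E.
have cosle : cos v <= cos c.
  move: cv; rewrite le_eqVlt => /predU1P[->//|cv].
  by apply: ltW; rewrite ltr_cos // in_itv /=; apply/andP; split; rewrite /v in cv *; lra.
have cv0 : 0 <= cos v.
  by apply: cos_ge0_pihalf; apply/andP; split; rewrite /v; lra.
have cx0 : 0 <= cos x by apply: cos_ge0_pihalf; apply/andP; split; lra.
have xv : x = v *+ 2 by rewrite /v mulr2n; lra.
have sx : sin x = (cos v * sin v) *+ 2 by rewrite {1}xv sin_mulr2n.
have cx : cos x = cos v ^+ 2 *+ 2 - 1 by rewrite {1}xv cos_mulr2n.
rewrite sx -/v E; rewrite cx in cx0.
have h1 : v * 1 <= v * (2 * cos v ^+ 2).
  by rewrite ler_wpM2l //; move: cx0; rewrite mulr2n; lra.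
have h2 : cos v * (cos v * v) <= cos v * (cos c * v).
  by rewrite ler_wpM2l // ler_wpM2r.
rewrite mulr2n; rewrite expr2 in h1; lra.
Qed.

Lemma norm_sin_ge_half x : `|x| <= pi / 2 -> `|x| / 2 <= `|sin x|.
Proof.
have [x0|x0] := leP 0 x; rewrite ?(ger0_norm x0) ?(ltr0_norm x0) => h.
  by apply: le_trans (ler_norm _); apply: sin_ge_half; rewrite x0.
rewrite -(normrN (sin x)) -sinN; apply: le_trans (ler_norm _).
by apply: sin_ge_half; rewrite oppr_ge0 ltW.
Qed.

(** Both zeros 0 and pi of the sine in this interval appear as factors; the
other factor is always at most 6. *)
Lemma norm_sin_ge x : - (pi / 2) <= x <= 3 * (pi / 2) ->
  `|x| * `|x - pi| / 12 <= `|sin x|.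
Proof.
move=> /andP[x1 x2].
have p4 : pi / 2 < 2 :> R := pihalf_lt2 R.
have p2 := @pi_ge2 R.
have [h|h] := leP x (pi / 2).
  have hx : `|x| <= pi / 2 by rewrite ler_norml; apply/andP; split.
  have h6 : `|x - pi| <= 6 by rewrite ler_norml; apply/andP; split; lra.
  apply: le_trans (norm_sin_ge_half hx).
  have := normr_ge0 x; nra.
have hx : `|x - pi| <= pi / 2 by rewrite ler_norml; apply/andP; split; lra.
have h6 : `|x| <= 6 by rewrite ler_norml; apply/andP; split; lra.
have -> : `|sin x| = `|sin (x - pi)|.
  by rewrite -{1}(subrK pi x) sinDpi normrN.
apply: le_trans (norm_sin_ge_half hx).
have := normr_ge0 (x - pi); nra.
Qed.

Lemma cabs_cisB x a : cabs (cis x - cis a) = 2 * `|sin ((x - a) / 2)|.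
Proof.
have E : cis x - cis a = (cos x - cos a) +i* (sin x - sin a) by [].
apply/eqP; rewrite -(eqrXn2 (n := 2)) ?cabs_ge0 ?mulr_ge0 //.
rewrite E cabs_sqr exprMn real_normK ?num_real // sin2cos2.
have cc : cos (x - a) = cos ((x - a) / 2) ^+ 2 *+ 2 - 1.
  by rewrite -cos_mulr2n; congr cos; rewrite mulr2n; lra.
move: cc; rewrite cosB mulr2n; set y := cos (_ / _) => cc.
have h1 := cos2Dsin2 x; have h2 := cos2Dsin2 a.
apply/eqP; nra.
Qed.

(** The point of the circle nearest to w is e^(ia), so
|e^(ix) - e^(ia)| <= 2 |e^(ix) - w|. The chord is 2 |sin((x - a) / 2)|, whose zeros
in the relevant range are x = a and x = a + 2 pi. *)
Lemma cis_dist_ge w : exists a, `|a| <= pi /\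
  forall x, 0 <= x <= 2 * pi ->
    (1 + cabs w) * (`|x - a| * `|x - (a + 2 * pi)|) / 144 <= cabs (cis x - w).
Proof.
have [a [ha Ew]] := polar_form w; exists a; split=> // x /andP[x0 x1].
set r := cabs w in Ew *; have r0 : 0 <= r by exact: cabs_ge0.
set d := cabs (cis x - w).
set e := cabs (cis x - cis a).
have e2 : e <= 2 by apply: le_trans (cabsD _ _) _; rewrite cabsN !cabs_cis.
have rd : `|r - 1| <= d.
  have h1 : r <= d + 1.
    have := cabsD (cis x) (- (cis x - w)).
    by rewrite subKr cabsN cabs_cis -/d -/r addrC.
  have h2 : 1 <= d + r.
    by have := cabsD (cis x - w) w; rewrite subrK cabs_cis.
  by rewrite ler_norml; apply/andP; split; lra.
have ed : e <= 2 * d.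
  have -> : e = cabs ((cis x - w) + (w - cis a)) by rewrite addrA subrK.
  apply: le_trans (cabsD _ _) _.
  have -> : w - cis a = (r - 1)%:C * cis a.
    by rewrite rmorphB rmorph1 mulrBl mul1r -Ew.
  rewrite cabsM cabs_cis mulr1 cabs_real; lra.
have d0 : 0 <= d by exact: cabs_ge0.
have rd' : r <= 1 + d by move: rd; rewrite ler_norml => /andP[]; lra.
have e0 : 0 <= e by exact: cabs_ge0.
(* 1 + r <= 2 + d, with e <= 2 d for the term 2 and e <= 2 for the term d *)
have key : e * (1 + r) <= 6 * d by nra.
move: ha; rewrite ler_norml => /andP[a1 a2].
have := @norm_sin_ge ((x - a) / 2); rewrite -/(pi / 2).
have -> : (x - a) / 2 - pi = (x - (a + 2 * pi)) / 2 by lra.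
rewrite !normrM (ger0_norm (x := 2^-1)) ?invr_ge0 // => h.
have {}h : `|x - a| * `|x - (a + 2 * pi)| / 48 <= `|sin ((x - a) / 2)|.
  apply: le_trans (h _); last by apply/andP; split; lra.
  by lra.
have Ee : e = 2 * `|sin ((x - a) / 2)| by exact: cabs_cisB.
move: (`|x - a| * _) h => P h.
have : P / 24 <= e by lra.
nra.
Qed.

(** The norm with r = 1 of X - z is 1 + |z|. *)
Lemma coef_cabs_roots (c : C) (s : seq C) n :
  cabs (c *: \prod_(z <- s) ('X - z%:P))`_n <= cabs c * \prod_(z <- s) (1 + cabs z).
Proof.
rewrite -lecR cabsE rmorphM /= cabsE rmorph_prod /=.
set q := _ *: _.
apply: (@le_trans _ _ (wnorm 1 q)).
  by have := coef_wnorm q n ler01; rewrite expr1n mulr1.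
rewrite /q wnormZ ler_wpM2l //.
elim: s {q} => [|z s IH]; first by rewrite !big_nil wnorm1.
rewrite !big_cons; apply: le_trans (wnormM _ _ ler01) _.
apply: ler_pM => //; try exact: wnorm_ge0.
apply: le_trans (wnormB _ _ ler01) _.
by rewrite wnormX wnormC rmorphD rmorph1 /= cabsE.
Qed.

(** The product of the 1 + |z| over the roots z bounds all the
coefficients of a monic polynomial. By cis_dist_ge it is, up to a geometric
factor, at most |q(e^(ix))| divided by the product of the distances from x to
two real points per root, and the hypothesis on T supplies an x at which the
latter product is not small. *)
Lemma bernstein_walsh_coef (T : set R) (delta : R) :
  T `<=` [set x | 0 <= x <= 2 * pi] -> 0 < delta ->
  (forall s : seq R, (forall a, a \in s -> `|a| <= 12) ->
      exists x, T x /\ delta ^+ size s <= \prod_(a <- s) `|x - a|) ->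
  exists L, 0 < L /\ forall (q : {poly C}) (A : R),
    (forall x, T x -> cabs q.[cis x] <= A) ->
    forall n, cabs q`_n <= A * L ^+ (size q).-1.
Proof.
move=> sT d0 HT.
exists (144 / delta ^+ 2); split; first by rewrite divr_gt0 // exprn_gt0.
move=> q A hq n.
have [q0|q0] := eqVneq q 0.
  have [//|x [Tx _]] := HT [::].
  have := hq x Tx; rewrite q0 horner0 coef0 size_poly0 /= expr0 mulr1.
  exact: le_trans.
have [r Eq] := closed_field_poly_normal q.
have [al hal] := choice cis_dist_ge.
(* two real points for each complex root *)
pose s := flatten [seq [:: al z; al z + 2 * pi] | z <- r].
have sr : size s = (size r * 2)%N.
  by rewrite size_flatten /shape -map_comp; elim: (r) => //= z t ->.
have sq : (size q).-1 = size r.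
  by rewrite {1}Eq size_scale ?lead_coef_eq0 // size_prod_XsubC.
have p4 : pi / 2 < 2 :> R := pihalf_lt2 R.
have hs a : a \in s -> `|a| <= 12.
  move=> /flatten_mapP[z _]; rewrite !inE.
  have [ha _] := hal z; have p0 := @pi_ge0 R.
  case/orP => /eqP ->; first by lra.
  apply: le_trans (ler_normD _ _) _; rewrite (ger0_norm (x := 2 * pi)); lra.
have [x [Tx hx]] := HT s hs.
have x02 := sT _ Tx.
have Eprod : \prod_(a <- s) `|x - a| =
    \prod_(z <- r) (`|x - al z| * `|x - (al z + 2 * pi)|).
  rewrite /s; elim: r {Eq sr sq hs s hx} => [|z r IH]; first by rewrite !big_nil.
  by rewrite /= !big_cons IH mulrA.
rewrite {}Eprod sr in hx.
have hqx := hq x Tx.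
have low : \prod_(z <- r) (1 + cabs z) * (delta ^+ (size r * 2) / 144 ^+ size r) <=
    \prod_(z <- r) cabs (cis x - z).
  apply: (@le_trans _ _ (\prod_(z <- r)
     ((1 + cabs z) * (`|x - al z| * `|x - (al z + 2 * pi)|) / 144))).
    rewrite big_split /= big_split /= big_const_seq count_predT iter_mulr_1 -mulrA ler_wpM2l //.
      by apply: prodr_ge0 => z _; rewrite addr_ge0 // cabs_ge0.
    by rewrite exprVn ler_wpM2r // invr_ge0 exprn_ge0.
  rewrite big_seq [leRHS]big_seq; apply: ler_prod => z _; have [_ hz] := hal z.
  rewrite hz // andbT divr_ge0 // mulr_ge0 ?mulr_ge0 // addr_ge0 //.
  exact: cabs_ge0.
rewrite Eq; apply: le_trans (coef_cabs_roots _ _ _) _; rewrite -Eq.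
have D0 : 0 < delta ^+ (size r * 2) by rewrite exprn_gt0.
have F0 : 0 < (144 : R) ^+ size r by rewrite exprn_gt0.
rewrite sq expr_div_n -exprM mulnC mulrA ler_pdivlMr //.
rewrite mulrA ler_pdivrMr // in low.
have Eqx : cabs q.[cis x] = cabs (lead_coef q) * \prod_(z <- r) cabs (cis x - z).
  rewrite {1}Eq hornerZ horner_prod cabsM cabs_prod; congr (_ * _).
  by apply: eq_bigr => z _; rewrite !hornerE.
apply: (@le_trans _ _ (cabs q.[cis x] * 144 ^+ size r)); last by rewrite ler_wpM2r // ltW.
by rewrite Eqx -!mulrA ler_wpM2l // cabs_ge0.
Qed.

End BernsteinWalsh.

(** * Residues of formal power series *)

Section Residue.
Variable K : numFieldType.
Implicit Types (p q u v w y z : {poly K}) (M n : nat).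

(** Congruence modulo X^M, which replaces equality of formal power
series. *)
Definition xcong M p q := exists r, p = q + r * 'X^M.

Lemma xcong_refl M p : xcong M p p.
Proof. by exists 0; rewrite mul0r addr0. Qed.

Lemma xcongD M p p' q q' : xcong M p p' -> xcong M q q' -> xcong M (p + q) (p' + q').
Proof. by move=> [r ->] [s ->]; exists (r + s); ring. Qed.

Lemma xcongM M p p' q q' : xcong M p p' -> xcong M q q' -> xcong M (p * q) (p' * q').
Proof.
by move=> [r ->] [s ->]; exists (p' * s + r * q' + r * s * 'X^M); ring.
Qed.

Lemma xcong_exp M p q n : xcong M p q -> xcong M (p ^+ n) (q ^+ n).
Proof.
move=> h; elim: n => [|n IH]; first exact: xcong_refl.
by rewrite !exprS; exact: xcongM.
Qed.

Lemma xcong_coef M p q n : xcong M p q -> (n < M)%N -> p`_n = q`_n.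
Proof. by move=> [r ->] nM; rewrite coefD coefMXn nM addr0. Qed.

(** The truncated Neumann series of u / u_0 - 1 is an inverse whose norm
does not depend on M. *)
Lemma xcong_inverse M (rho : K) u : 0 <= rho -> 1 <= `|u`_0| ->
  wnorm rho (u - (u`_0)%:P) <= 2^-1 ->
  exists y, xcong M (u * y) 1 /\ wnorm rho y <= 2.
Proof.
move=> rho0 u1 hu; set c := u`_0 in u1 hu.
have c0 : c != 0 by rewrite -normr_gt0 (lt_le_trans ltr01).
have ci : `|c^-1| <= 1 by rewrite normfV invf_le1 // (lt_le_trans ltr01).
pose d := c^-1 *: (u - c%:P).
have Eu : u = c%:P * (1 + d).
  rewrite mul_polyC scalerDr /d scalerA mulfV // scale1r.
  by rewrite alg_polyC addrC subrK.
have d2 : wnorm rho d <= 2^-1.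
  rewrite /d wnormZ -[leRHS]mul1r; apply: ler_pM => //; exact: wnorm_ge0.
have [d1 Ed] : exists d1, d = d1 * 'X.
  have : d`_0 = 0 by rewrite coefZ coefB coefC subrr mulr0.
  elim/poly_ind: (d) => [|d1 e _]; first by exists 0; rewrite mul0r.
  by rewrite coefD coefMX coefC eqxx add0r => ->; exists d1; rewrite addr0.
exists (c^-1 *: \sum_(k < M) (- d) ^+ k); split.
  exists (- (- d1) ^+ M).
  have E : (- d) ^+ M - 1 = (- d - 1) * \sum_(k < M) (- d) ^+ k.
    by rewrite subrX1.
  rewrite -mul_polyC Eu.
  have -> : c%:P * (1 + d) * ((c^-1)%:P * \sum_(k < M) (- d) ^+ k) =
     (c%:P * (c^-1)%:P) * - ((- d - 1) * \sum_(k < M) (- d) ^+ k) by ring.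
  have EM : (- d) ^+ M = (- d1) ^+ M * 'X^M by rewrite Ed -mulNr exprMn.
  by rewrite -E -polyCM mulfV // mul1r EM; ring.
rewrite wnormZ; apply: (@le_trans _ _ (1 * 2)); last by rewrite mul1r.
apply: ler_pM => //; first exact: wnorm_ge0.
apply: le_trans (wnorm_sum _ _ _ rho0) _.
apply: (@le_trans _ _ (\sum_(k < M) 2^-1 ^+ k)).
  apply: ler_sum => k _; apply: le_trans (wnormX_le _ _ rho0) _.
  by rewrite wnormN lerXn2r ?nnegrE // ?wnorm_ge0.
suff : \sum_(k < M) 2^-1 ^+ k + 2 * 2^-1 ^+ M = 2 :> K.
  by move=> E; rewrite -[leRHS]E lerDl mulr_ge0 // exprn_ge0.
elim: (M) => [|m IH]; first by rewrite big_ord0 add0r expr0 mulr1.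
by rewrite -[RHS]IH big_ord_recr /= exprS; field.
Qed.

Lemma residue_coef0 M w y : xcong M (w * y) 1 -> (0 < M)%N ->
  (y * (2 *: w + 'X * w^`()))`_0 = 2.
Proof.
move=> h M0; rewrite mulrDr coefD mulrCA coefXM eqxx addr0.
by rewrite -scalerAr coefZ [y * w]mulrC (xcong_coef h) // coefC mulr1.
Qed.

(** With y = 1/w, and s = t^2 w for which ds = t (2 w + t w') dt, this
coefficient is the residue of s^-(e+1) ds, an exact differential. *)
Lemma residue_coef_eq0 M w y e : xcong M (w * y) 1 -> (0 < e)%N -> (2 * e < M)%N ->
  (y ^+ e.+1 * (2 *: w + 'X * w^`()))`_(2 * e) = 0.
Proof.
move=> h e0 eM.
have hd : xcong M ('X * (w * y)^`()) 0.
  have [r ->] := h; case: M {h} eM => // M _.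
  exists (r^`() * 'X + r *+ M.+1).
  rewrite derivD derivC derivM derivXn /= exprS -mulr_natr.
  rewrite -[r *+ _]mulr_natr -[_ *+ M.+1]mulr_natr; ring.
case: e e0 eM => // e _ eM.
have hc : xcong M (y ^+ e.+2 * (2 *: w + 'X * w^`()))
     (2 *: y ^+ e.+1 - 'X * (y ^+ e * y^`())).
  have -> : y ^+ e.+2 * (2 *: w + 'X * w^`()) =
     2 *: (y ^+ e.+1) * (w * y) +
     (y ^+ e.+1 * ('X * (w * y)^`()) + - ('X * (y ^+ e * y^`())) * (w * y)).
    rewrite derivM -!mul_polyC !exprS; ring.
  have -> : 2 *: y ^+ e.+1 - 'X * (y ^+ e * y^`()) =
     2 *: (y ^+ e.+1) * 1 +
     (y ^+ e.+1 * 0 + - ('X * (y ^+ e * y^`())) * 1) by ring.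
  do ! [apply: xcongD | apply: xcongM | exact: xcong_refl | exact: h | exact: hd].
rewrite (xcong_coef hc) // coefB coefZ.
apply: (@mulfI _ (e.+1)%:R); first by rewrite pnatr_eq0.
rewrite mulr0 mulrBr.
suff -> : (e.+1)%:R * ('X * (y ^+ e * y^`()))`_(2 * e.+1) =
    (2 * e.+1)%:R * (y ^+ e.+1)`_(2 * e.+1) by rewrite natrM; ring.
rewrite -coefZ.
have -> : (e.+1)%:R *: ('X * (y ^+ e * y^`())) = 'X * (y ^+ e.+1)^`().
  by rewrite deriv_exp /= scaler_nat mulrnAr [y^`() * _]mulrC.
rewrite coefXM /= coef_deriv mulr_natl.
by have -> : (2 * e.+1).-1.+1 = (2 * e.+1)%N by [].
Qed.

(** The residue formula for the coefficients of a series in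
s = (X u) (X v), applied to the part of the double series of frequency
k - 2 l = k0 - 2 l0, with y = 1/u and z = 1/v. The terms of this frequency differ
from the (k0, l0) one by powers of s, whose residues vanish. *)
Lemma residue_extract (a : nat -> nat -> K) k0 l0 u v y z : (l0 <= k0)%N ->
  xcong k0.+1 (u * y) 1 -> xcong k0.+1 (v * z) 1 ->
  2 * a k0 l0 =
  \sum_(n < k0.+1)
    (\sum_(k < n.+1) \sum_(l < k.+1 | (k + 2 * l0 == k0 + 2 * l)%N)
        a k l * (('X * u) ^+ (k - l) * ('X * v) ^+ l)`_n) *
    (y ^+ (k0 - l0).+1 * z ^+ l0.+1 *
       (2 *: (u * v) + 'X * (u * v)^`()))`_(k0 - n).
Proof.
move=> lk hu hv; set g := y ^+ _ * z ^+ _ * _.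
pose psi k l := ('X * u) ^+ (k - l) * ('X * v) ^+ l.
pose H := \sum_(k < k0.+1) \sum_(l < k.+1 | (k + 2 * l0 == k0 + 2 * l)%N)
   a k l *: psi k l.
have psiE k l : (l <= k)%N -> psi k l = 'X^k * (u ^+ (k - l) * v ^+ l).
  move=> h; rewrite /psi !exprMn.
  have -> : 'X^k = 'X^(k - l) * 'X^l :> {poly K} by rewrite -exprD subnK.
  by ring.
have HE n : (n < k0.+1)%N -> H`_n =
    \sum_(k < n.+1) \sum_(l < k.+1 | (k + 2 * l0 == k0 + 2 * l)%N)
        a k l * (psi k l)`_n.
  move=> nk; rewrite /H coef_sum.
  rewrite (big_ord_widen _ (fun k => \sum_(l < k.+1 | (k + 2 * l0 == k0 + 2 * l)%N)
        a k l * (psi k l)`_n) nk) [RHS]big_mkcond.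
  apply: eq_bigr => k _; rewrite coef_sum; case: ifP => [_|].
    by apply: eq_bigr => l _; rewrite coefZ.
  move=> /negbT; rewrite -leqNgt => kn; apply: big1 => l _.
  by rewrite coefZ psiE ?coefXnM ?kn ?mulr0 // -ltnS.
transitivity (H * g)`_k0; last first.
  by rewrite coefM; apply: eq_bigr => n _; rewrite HE.
rewrite /H mulr_suml coef_sum big_ord_recr /= big1 ?add0r => [|k _]; last first.
  rewrite mulr_suml coef_sum big1 // => l /eqP hl.
  have kk0 : (k < k0)%N by exact: ltn_ord.
  have lk' : (l <= k)%N by rewrite -ltnS.
  rewrite -scalerAl coefZ psiE // -mulrA coefXnM.
  rewrite ltnNge (ltnW kk0) /=.
  have [e Ee] : exists e, (l0 = l + e)%N /\ (0 < e)%N /\ (k0 - k = 2 * e)%N.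
    exists (l0 - l)%N; lia.
  have [E1 [E2 E3]] := Ee; rewrite E3.
  have Ek : (k0 - l0 = (k - l) + e)%N by lia.
  suff h : xcong k0.+1 (u ^+ (k - l) * v ^+ l * g)
      ((y * z) ^+ e.+1 * (2 *: (u * v) + 'X * (u * v)^`())).
    rewrite (xcong_coef h); last by lia.
    rewrite (residue_coef_eq0 (M := k0.+1)) ?mulr0 //; last by lia.
    have -> : u * v * (y * z) = (u * y) * (v * z) by ring.
    by rewrite -[1]mulr1; exact: xcongM.
  have -> : u ^+ (k - l) * v ^+ l * g =
      (u * y) ^+ (k - l) * (v * z) ^+ l *
      ((y * z) ^+ e.+1 * (2 *: (u * v) + 'X * (u * v)^`())).
    rewrite /g Ek {1}E1 -!addnS !exprD !exprMn; ring.
  rewrite -[X in xcong _ _ X]mul1r; apply: xcongM; last exact: xcong_refl.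
  have -> : 1 = 1 ^+ (k - l) * 1 ^+ l :> {poly K} by rewrite !expr1n mulr1.
  by apply: xcongM; apply: xcong_exp.
have l0k : (l0 < k0.+1)%N by [].
rewrite mulr_suml coef_sum (bigD1 (Ordinal l0k)) //= big1 ?addr0; last first.
  by move=> l /andP[/eqP h /eqP]; case; apply: val_inj => /=; lia.
rewrite -scalerAl coefZ psiE // -mulrA coefXnM ltnn subnn mulrC; congr (_ * _).
have h : xcong k0.+1 (u ^+ (k0 - l0) * v ^+ l0 * g)
      ((y * z) * (2 *: (u * v) + 'X * (u * v)^`())).
  have -> : u ^+ (k0 - l0) * v ^+ l0 * g =
      (u * y) ^+ (k0 - l0) * (v * z) ^+ l0 *
      ((y * z) * (2 *: (u * v) + 'X * (u * v)^`())).
    rewrite /g !exprS !exprMn; ring.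
  rewrite -[X in xcong _ _ X]mul1r; apply: xcongM; last exact: xcong_refl.
  have -> : 1 = 1 ^+ (k0 - l0) * 1 ^+ l0 :> {poly K} by rewrite !expr1n mulr1.
  by apply: xcongM; apply: xcong_exp.
rewrite (xcong_coef h) // (residue_coef0 (M := k0.+1)) //.
have -> : u * v * (y * z) = (u * y) * (v * z) by ring.
by rewrite -[1]mulr1; exact: xcongM.
Qed.

End Residue.

(** * Conjugate coordinates *)

Section ConjugateCoordinates.
Local Open Scope complex_scope.
Variable R : realType.
Local Notation C := R[i].
Implicit Types (x y : {poly C}) (k l n N : nat).

Definition imagC : C := 0 +i* 1.
Local Notation iC := imagC.

Lemma iC2 : iC * iC = -1.
Proof. by rewrite /imagC; simpc. Qed.

Lemma iC_neq0 : iC != 0.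
Proof. by rewrite eq_complex /= oner_eq0 andbF. Qed.

(** Induction on the degree, using that x and y are combinations of
x + i y and x - i y. Stated for polynomials x and y, so that it can be evaluated
both along a curve and at (X, 1). *)
Lemma conjugate_coordinates k (b : nat -> C) : exists a : nat -> C, forall x y,
  \sum_(i < k.+1) b i *: (x ^+ i * y ^+ (k - i)) =
  \sum_(l < k.+1) a l *: ((x + iC *: y) ^+ (k - l) * (x - iC *: y) ^+ l).
Proof.
elim: k b => [|k IH] b.
  by exists b => x y; rewrite !big_ord1 !expr0.
have [a1 h1] := IH (fun i => b i.+1).
have [a2 h2] := IH (fun i => if i == 0%N then b 0%N else 0).
pose c : C := (2 * iC)^-1.
pose al l := 2^-1 * a1 l + c * a2 l.
pose be l := 2^-1 * a1 l - c * a2 l.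
exists (fun l => (if (l < k.+1)%N then al l else 0) +
   (if l is l'.+1 then be l' else 0)) => x y.
set p := x + iC *: y; set q := x - iC *: y.
have Ex : x = 2^-1 *: (p + q).
  have -> : p + q = 2 *: x by rewrite /p /q scaler_nat; ring.
  by rewrite scalerA mulVf ?scale1r // pnatr_eq0.
have Ey : y = c *: (p - q).
  have -> : p - q = (2 * iC) *: y by rewrite /p /q -scalerA scaler_nat; ring.
  by rewrite scalerA mulVf ?scale1r // mulf_neq0 ?iC_neq0 ?pnatr_eq0.
have -> : \sum_(i < k.+2) b i *: (x ^+ i * y ^+ (k.+1 - i)) =
  y * (\sum_(i < k.+1) (if i == 0%N :> nat then b 0%N else 0) *: (x ^+ i * y ^+ (k - i))) +
  x * (\sum_(i < k.+1) b i.+1 *: (x ^+ i * y ^+ (k - i))).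
  rewrite big_ord_recl; congr (_ + _).
    rewrite big_ord_recl big1 => [|i _]; last by rewrite scale0r.
    by rewrite /= addr0 !expr0 !mul1r subn0 subn0 -scalerAr exprS.
  rewrite mulr_sumr; apply: eq_bigr => i _.
  by rewrite /= /bump leq0n add1n subSS -scalerAr mulrA -exprS.
rewrite h1 h2 -/p -/q.
have -> : \sum_(l < k.+2) ((if (l < k.+1)%N then al l else 0) +
     (if nat_of_ord l is l'.+1 then be l' else 0)) *: (p ^+ (k.+1 - l) * q ^+ l) =
  p * (\sum_(l < k.+1) al l *: (p ^+ (k - l) * q ^+ l)) +
  q * (\sum_(l < k.+1) be l *: (p ^+ (k - l) * q ^+ l)).
  under eq_bigr do rewrite scalerDl.
  rewrite big_split /=; congr (_ + _).
    rewrite big_ord_recr /= ltnn scale0r addr0 mulr_sumr.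
    apply: eq_bigr => l _; rewrite ltn_ord -scalerAr subSn; last by rewrite -ltnS.
    by rewrite exprS mulrA.
  rewrite big_ord_recl /= scale0r add0r mulr_sumr; apply: eq_bigr => l _.
  by rewrite /bump leq0n add1n subSS -scalerAr exprS; congr (_ *: _); ring.
have Eal : \sum_(l < k.+1) al l *: (p ^+ (k - l) * q ^+ l) =
   2^-1 *: (\sum_(l < k.+1) a1 l *: (p ^+ (k - l) * q ^+ l)) +
   c *: (\sum_(l < k.+1) a2 l *: (p ^+ (k - l) * q ^+ l)).
  rewrite !scaler_sumr -big_split; apply: eq_bigr => l _ /=.
  by rewrite !scalerA -scalerDl.
have Ebe : \sum_(l < k.+1) be l *: (p ^+ (k - l) * q ^+ l) =
   2^-1 *: (\sum_(l < k.+1) a1 l *: (p ^+ (k - l) * q ^+ l)) -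
   c *: (\sum_(l < k.+1) a2 l *: (p ^+ (k - l) * q ^+ l)).
  rewrite !scaler_sumr -sumrB; apply: eq_bigr => l _ /=.
  by rewrite !scalerA -scalerBl.
rewrite Eal Ebe {1}Ex {1}Ey.
move: (\sum_(l < k.+1) a1 l *: _) (\sum_(l < k.+1) a2 l *: _) => S1 S2.
rewrite -!mul_polyC; ring.
Qed.

Lemma cabs_sum n (F : 'I_n -> C) :
  cabs (\sum_(i < n) F i) <= \sum_(i < n) cabs (F i).
Proof.
rewrite -lecR cabsE rmorph_sum /=; under [leRHS]eq_bigr do rewrite cabsE.
exact: ler_norm_sum.
Qed.

Lemma wnorm_map (r : R) (p : {poly R}) :
  wnorm r%:C (map_poly (real_complex R) p) = (wnorm r p)%:C.
Proof.
rewrite (@wnorm_wide _ _ _ (size p)) ?size_poly // /wnorm rmorph_sum.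
apply: eq_bigr => i _; rewrite /= coef_map /= rmorphM rmorphXn /=.
by rewrite -cabsE cabs_real.
Qed.

Definition xcurve (f : nat -> R) N (th : R) : {poly R} :=
  cos th *: 'X + sin th *: (\poly_(i < N) f i).
Definition ycurve (f : nat -> R) N (th : R) : {poly R} :=
  - sin th *: 'X + cos th *: (\poly_(i < N) f i).

(** With s = i and s = - i these are psi = t + i phi and psibar, with phi truncated
at order N. *)
Definition zcurve (s : C) (f : nat -> R) N : {poly C} :=
  'X + s *: map_poly (real_complex R) (\poly_(i < N) f i).

Lemma xycurve_z f N th :
  map_poly (real_complex R) (xcurve f N th) +
    iC *: map_poly (real_complex R) (ycurve f N th) =
  cis (- th) *: zcurve iC f N.
Proof.
rewrite /xcurve /ycurve !raddfD /= !map_polyZ /= !map_polyX.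
set Phi := map_poly _ _.
have -> : cis (- th) = (cos th)%:C - iC * (sin th)%:C.
  by rewrite /cis cosN sinN /imagC; simpc.
rewrite /zcurve -!mul_polyC !(rmorphB, rmorphM, rmorphN) /=.
have h : iC%:P * iC%:P = -1 :> {poly C} by rewrite -polyCM iC2 polyCN.
transitivity ((cos th)%:C%:P * 'X + (sin th)%:C%:P * Phi +
  iC%:P * (- (sin th)%:C%:P * 'X + (cos th)%:C%:P * Phi)); first by ring.
transitivity ((cos th)%:C%:P * 'X + (cos th)%:C%:P * iC%:P * Phi
   - iC%:P * (sin th)%:C%:P * 'X - (iC%:P * iC%:P) * (sin th)%:C%:P * Phi); last by ring.
by rewrite h; ring.
Qed.

Lemma xycurve_zbar f N th :
  map_poly (real_complex R) (xcurve f N th) -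
    iC *: map_poly (real_complex R) (ycurve f N th) =
  cis th *: zcurve (- iC) f N.
Proof.
rewrite /xcurve /ycurve !raddfD /= !map_polyZ /= !map_polyX.
set Phi := map_poly _ _.
have -> : cis th = (cos th)%:C + iC * (sin th)%:C.
  by rewrite /cis /imagC; simpc.
rewrite /zcurve -!mul_polyC !(rmorphD, rmorphB, rmorphM, rmorphN) /=.
have h : iC%:P * iC%:P = -1 :> {poly C} by rewrite -polyCM iC2 polyCN.
transitivity ((cos th)%:C%:P * 'X + (sin th)%:C%:P * Phi -
  iC%:P * (- (sin th)%:C%:P * 'X + (cos th)%:C%:P * Phi)); first by ring.
transitivity ((cos th)%:C%:P * 'X - (cos th)%:C%:P * iC%:P * Phi
   + iC%:P * (sin th)%:C%:P * 'X - (iC%:P * iC%:P) * (sin th)%:C%:P * Phi); last by ring.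
by rewrite h; ring.
Qed.

Lemma cisM (s t : R) : cis s * cis t = cis (s + t).
Proof. by rewrite /cis cosD sinD; simpc; congr (_ +i* _); ring. Qed.

Lemma cisNM (th : R) : cis th * cis (- th) = 1.
Proof. by rewrite cisM subrr /cis cos0 sin0. Qed.

End ConjugateCoordinates.

(** * Geometric bounds for the formal Taylor series *)

Section FormalBound.
Local Open Scope complex_scope.
Variable R : realType.
Local Notation C := R[i].
Local Notation iC := (imagC R).
Implicit Types (f : nat -> R) (b : nat -> nat -> R) (a : nat -> nat -> C).
Implicit Types (k l n N : nat) (th : R).

Lemma psum2_conj b : exists a,
  (forall N (p q : {poly R}), map_poly (real_complex R) (psum2_poly b N p q) =
    \sum_(k < N) \sum_(l < k.+1) a k l *:
     ((map_poly (real_complex R) p + iC *: map_poly (real_complex R) q) ^+ (k - l) *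
      (map_poly (real_complex R) p - iC *: map_poly (real_complex R) q) ^+ l)) /\
  (forall k, \sum_(i < k.+1) (b i (k - i)%N)%:C *: 'X^i =
    \sum_(l < k.+1) a k l *: (('X + iC%:P) ^+ (k - l) * ('X - iC%:P) ^+ l)).
Proof.
have /choice[a ha] := fun k => @conjugate_coordinates R k (fun i => (b i (k - i)%N)%:C).
exists a; split=> [N p q|k].
  rewrite /psum2_poly raddf_sum; apply: eq_bigr => k _; rewrite -ha raddf_sum.
  by apply: eq_bigr => i _; rewrite /= map_polyZ rmorphM !rmorphXn.
have := ha k 'X 1; rewrite !alg_polyC => <-.
by apply: eq_bigr => i _; rewrite expr1n mulr1.
Qed.

Lemma zcurve_factor (s : C) f N : f 0%N = 0 -> zcurve s f N.+1 =
  'X * (1 + s *: map_poly (real_complex R) (\poly_(i < N) f i.+1)).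
Proof.
move=> f0; rewrite /zcurve mulrDr mulr1 -scalerAr; congr (_ + _ *: _).
apply/polyP => -[|i]; rewrite coefXM /= !coef_map /= !coef_poly /= ?f0 //.
Qed.

(** The n-th Taylor coefficient along the curve of angle theta, times
e^(i n theta), as a polynomial in e^(i theta). The multiplication removes the
negative frequencies. *)
Definition trig_poly a f N n : {poly C} :=
  \sum_(k < n.+1) \sum_(l < k.+1)
    (a k l * (zcurve iC f N ^+ (k - l) * zcurve (- iC) f N ^+ l)`_n)
      *: 'X^(n - k + 2 * l).

Lemma size_trig_poly a f N n : ((size (trig_poly a f N n)).-1 <= 2 * n)%N.
Proof.
suff : (size (trig_poly a f N n) <= (2 * n).+1)%N by case: (size _).
apply: leq_trans (size_sum _ _ _) _; apply/bigmax_leqP => k _.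
apply: leq_trans (size_sum _ _ _) _; apply/bigmax_leqP => l _.
apply: leq_trans (size_scale_leq _ _) _; rewrite size_polyXn.
have := ltn_ord k; have := ltn_ord l; lia.
Qed.

Lemma zcurve_pow_coef_eq0 f N k l n : f 0%N = 0 -> (l <= k)%N -> (n < k)%N ->
  (zcurve iC f N.+1 ^+ (k - l) * zcurve (- iC) f N.+1 ^+ l)`_n = 0.
Proof.
move=> f0 lk nk; rewrite !zcurve_factor // !exprMn mulrACA -exprD subnK //.
by rewrite coefXnM nk.
Qed.

Lemma trig_polyE b a f N n th : f 0%N = 0 -> (n < N)%N ->
  (forall N (p q : {poly R}), map_poly (real_complex R) (psum2_poly b N p q) =
    \sum_(k < N) \sum_(l < k.+1) a k l *:
     ((map_poly (real_complex R) p + iC *: map_poly (real_complex R) q) ^+ (k - l) *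
      (map_poly (real_complex R) p - iC *: map_poly (real_complex R) q) ^+ l)) ->
  cis th ^+ n * ((psum2_poly b N (xcurve f N th) (ycurve f N th))`_n)%:C =
  (trig_poly a f N n).[cis th].
Proof.
case: N => // N f0 nN ha.
rewrite -[(_`_n)%:C](coef_map (real_complex R)) /= ha xycurve_z xycurve_zbar.
rewrite coef_sum horner_sum.
rewrite (big_ord_widen _ (fun k => (\sum_(l < k.+1)
    (a k l * (zcurve iC f N.+1 ^+ (k - l) * zcurve (- iC) f N.+1 ^+ l)`_n)
      *: 'X^(n - k + 2 * l)).[cis th]) nN) [RHS]big_mkcond mulr_sumr.
apply: eq_bigr => k _; rewrite coef_sum mulr_sumr.
have E (l : 'I_k.+1) : (a k l *: ((cis (- th) *: zcurve iC f N.+1) ^+ (k - l) *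
       (cis th *: zcurve (- iC) f N.+1) ^+ l))`_n =
   a k l * (cis (- th) ^+ (k - l) * cis th ^+ l *
     (zcurve iC f N.+1 ^+ (k - l) * zcurve (- iC) f N.+1 ^+ l)`_n).
  by rewrite coefZ !exprZn -scalerAl -scalerAr scalerA coefZ.
case: ifP => [kn|/negbT]; last first.
  rewrite -leqNgt => nk; apply: big1 => l _; rewrite E zcurve_pow_coef_eq0 ?mulr0 //.
  by rewrite -ltnS.
rewrite horner_sum; apply: eq_bigr => l _; rewrite E hornerZ hornerXn.
have lk : (l <= k)%N by rewrite -ltnS.
have -> : cis th ^+ (n - k + 2 * l) = cis th ^+ n * (cis (- th) ^+ (k - l) * cis th ^+ l).
  have -> : n = (n - k + l + (k - l))%N by rewrite ltnS in kn; lia.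
  rewrite [in RHS]exprD -!mulrA [cis th ^+ (k - l) * _]mulrA -exprMn cisNM expr1n mul1r.
  by rewrite -exprD; congr (_ ^+ _); rewrite ltnS in kn; lia.
ring.
Qed.

(** Because n <= 2^n. *)
Lemma wnorm_Xderiv (rho : C) (p : {poly C}) : 0 <= rho ->
  wnorm rho ('X * p^`()) <= wnorm (2 * rho) p.
Proof.
move=> rho0; rewrite (@wnorm_wide _ _ _ (size p)); last first.
  have [->|p0] := eqVneq p 0; first by rewrite deriv0 mulr0 size_poly0.
  have [d0|d0] := eqVneq p^`() 0; first by rewrite d0 mulr0 size_poly0.
  by rewrite -commr_polyX size_mulX // lt_size_deriv.
apply: ler_sum => i _; rewrite coefXM; case: eqP => [i0|/eqP].
  by rewrite normr0 mul0r mulr_ge0 // exprn_ge0 // mulr_ge0.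
rewrite -lt0n => i0; rewrite coef_deriv prednK // normrMn exprMn.
rewrite -[X in X * _ <= _]mulr_natr -mulrA ler_wpM2l // ler_wpM2r ?exprn_ge0 //.
by rewrite -natrX ler_nat ltnW // ltn_expl.
Qed.

Lemma cabs_1DiC (c : R) : 1 <= cabs (1 + iC * c%:C) /\ 1 <= cabs (1 - iC * c%:C).
Proof.
have h (d : R) : 1 <= cabs (1 +i* d).
  by rewrite cabs_def expr1n -[leLHS]sqrtr1 ler_wsqrtr // lerDl sqr_ge0.
have -> : 1 + iC * c%:C = 1 +i* c by rewrite /imagC; simpc.
have -> : 1 - iC * c%:C = 1 +i* (- c) by rewrite /imagC; simpc.
by [].
Qed.

(** The unit is psi / t or psibar / t; its constant term 1 + s phi'(0) has
modulus at least 1 because phi is real. *)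
Lemma zcurve_unit_inverse f (rho : R) (s : C) N M :
  0 <= rho -> `|s| = 1 -> (forall c : R, 1 <= cabs (1 + s * c%:C)) ->
  let P := \poly_(i < N) f i.+1 in
  wnorm rho (P - (P`_0)%:P) <= 2^-1 ->
  exists y, xcong M ((1 + s *: map_poly (real_complex R) P) * y) 1 /\
     wnorm rho%:C y <= 2.
Proof.
move=> rho0 s1 hs P hP; set u := 1 + _.
have Eu0 : u`_0 = 1 + s * (P`_0)%:C by rewrite coefD coef1 coefZ coef_map.
apply: xcong_inverse.
- by rewrite ler0c.
- by rewrite Eu0 -cabsE -(rmorph1 (real_complex R)) lecR.
have -> : u - (u`_0)%:P = s *: map_poly (real_complex R) (P - (P`_0)%:P).
  rewrite Eu0 raddfB /= map_polyC /= scalerBr /u polyCD polyCM mul_polyC.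
  ring.
rewrite wnormZ s1 mul1r wnorm_map.
by rewrite -[2^-1](_ : (2^-1)%:C = _) ?lecR // fmorphV rmorph_nat.
Qed.


Lemma real_complex_nat n : (n%:R : R)%:C = n%:R :> C.
Proof. by rewrite rmorph_nat. Qed.

Lemma real_complex2 : (2 : R)%:C = 2 :> C.
Proof. exact: (real_complex_nat 2). Qed.

(** In the residue formula the Taylor coefficients along the curves are
bounded by hypothesis, and the remaining factor by submultiplicativity of the
norm at a radius where psi / t and psibar / t are close to their constant
terms. *)
Lemma conj_coef_bound a f (r M G : R) : f 0%N = 0 -> 0 < r -> 0 <= M ->
  (forall N, wnorm r (\poly_(i < N) f i) <= M) -> 1 <= G ->
  (forall N n s, (n < N)%N -> cabs (trig_poly a f N n)`_s <= G ^+ (2 * n).+1) ->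
  exists L, 1 <= L /\ forall k l, (l <= k)%N -> cabs (a k l) <= L ^+ k.+1.
Proof.
move=> f0 r0 M0 hM G1 hG.
pose P N := \poly_(i < N) f i.+1.
pose M1 := M / r.
have M10 : 0 <= M1 by rewrite divr_ge0 // ltW.
have hP N : wnorm r (P N) <= M1.
  rewrite ler_pdivlMr // mulrC -wnormXM; apply: le_trans (hM N.+1).
  rewrite le_eqVlt; apply/orP; left; apply/eqP; congr wnorm.
  by apply/polyP => -[|i]; rewrite coefXM /= !coef_poly /= ?f0.
(* at radius lam r the units psi / t and psibar / t are within 1/2 of their
   constant terms *)
pose lam := (4 * (M1 + 1))^-1.
have lam0 : 0 < lam by rewrite invr_gt0 mulr_gt0 // ltr_wpDl.
have lam4 : lam <= 4^-1.
  by rewrite lef_pV2 ?posrE ?mulr_gt0 ?ltr_wpDl // ler_peMr // lerDr.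
have lam1 : 0 <= lam <= 1 by rewrite ltW //=; apply: le_trans lam4 _; lra.
pose rho := lam * r; have rho0 : 0 < rho by rewrite mulr_gt0.
have rho2 : 2 * rho <= r by rewrite /rho mulrA ler_piMl ?(ltW r0) //; lra.
have hP0 N : wnorm rho (P N - ((P N)`_0)%:P) <= 2^-1.
  apply: le_trans (wnorm_shrink r0 lam1 _) _; first by rewrite coefB coefC subrr.
  have : wnorm r (P N - ((P N)`_0)%:P) <= 2 * (M1 + 1).
    apply: le_trans (wnormB _ _ (ltW r0)) _; rewrite wnormC.
    have := coef_wnorm (P N) 0 (ltW r0); rewrite expr0 mulr1.
    have := hP N; lra.
  move=> h; apply: le_trans (ler_wpM2l (ltW lam0) h) _.
  rewrite /lam -(ler_pM2r (_ : 0 < 4)) // mulrAC.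
  have : M1 + 1 != 0 by rewrite gt_eqF // ltr_wpDl.
  move=> h1; rewrite le_eqVlt; apply/orP; left; apply/eqP; by field.
clearbody rho.
pose U := 1 + M1.
pose W := 3 * U ^+ 2.
have U1 : 1 <= U by rewrite lerDl.
have hu (s : C) N : `|s| = 1 ->
    wnorm (2 * rho)%:C (1 + s *: map_poly (real_complex R) (P N)) <= U%:C.
  move=> s1; have r20 : 0 <= 2 * rho by rewrite mulr_ge0 // ltW.
  apply: le_trans (wnormD _ _ _) _; first by rewrite ler0c.
  rewrite wnorm1 wnormZ s1 mul1r wnorm_map rmorphD rmorph1 lerD2l lecR.
  exact: le_trans (ler_wnorm _ r20 rho2) (hP N).
have n1 : `|iC| = 1 by rewrite -cabsE cabs_def expr0n expr1n add0r sqrtr1.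
have n2 : `|- iC| = 1 by rewrite normrN.
pose G' := Num.max G rho^-1.
have GG' : G <= G' by rewrite le_max lexx.
have rG' : rho^-1 <= G' by rewrite le_max lexx orbT.
have G'1 : 1 <= G' by apply: le_trans GG'.
have W0 : 0 <= W by rewrite mulr_ge0 // exprn_ge0 // (le_trans ler01).
exists (4 * G' ^+ 2 * (W + 1)); split.
  have G'2 : 1 <= G' ^+ 2 by rewrite exprn_ege1.
  by nra.
move=> k0 l0 lk.
have [y [hy ny]] := @zcurve_unit_inverse f rho iC k0 k0.+1 (ltW rho0) n1
   (fun c => (cabs_1DiC c).1) (hP0 k0).
have low (c : R) : 1 <= cabs (1 + - iC * c%:C).
  by rewrite mulNr; have [] := cabs_1DiC c.
have [z [hz nz]] := @zcurve_unit_inverse f rho (- iC) k0 k0.+1 (ltW rho0) n2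
   low (hP0 k0).
have E := residue_extract a lk hy hz.
rewrite -!zcurve_factor // in E.
move: hy hz E; set u := 1 + iC *: _; set v := 1 + - iC *: _ => hy hz.
set g := y ^+ _ * z ^+ _ * _ => E.
have rC0 : 0 <= rho%:C by rewrite ler0c ltW.
have hg : wnorm rho%:C g <= (2 ^+ k0.+2 * W)%:C.
  have Ek : (2 ^+ k0.+2 * W)%:C = 2 ^+ (k0 - l0).+1 * 2 ^+ l0.+1 * W%:C :> C.
    have e2 : 2 ^+ (k0 - l0).+1 * 2 ^+ l0.+1 = 2 ^+ k0.+2 :> C.
      by rewrite -exprD addSn addnS subnK.
    by rewrite {}e2 rmorphM rmorphXn /= real_complex2.
  rewrite {}Ek.
  apply: le_trans (wnormM _ _ rC0) _; apply: ler_pM; rewrite ?wnorm_ge0 //.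
    apply: le_trans (wnormM _ _ rC0) _; apply: ler_pM; rewrite ?wnorm_ge0 //.
      apply: le_trans (wnormX_le _ _ rC0) _.
      by rewrite lerXn2r ?nnegrE // wnorm_ge0.
    apply: le_trans (wnormX_le _ _ rC0) _.
    by rewrite lerXn2r ?nnegrE // wnorm_ge0.
  have r2C : 2 * rho%:C = (2 * rho)%:C.
    by rewrite (rmorphM (real_complex R) 2 rho) /= real_complex2.
  have r2C0 : 0 <= 2 * rho%:C by rewrite mulr_ge0.
  have huv : wnorm (2 * rho%:C) (u * v) <= (U ^+ 2)%:C.
    apply: le_trans (wnormM _ _ r2C0) _; rewrite expr2 rmorphM r2C /=.
    by apply: ler_pM; rewrite -?r2C ?wnorm_ge0 // r2C hu.
  apply: le_trans (wnormD _ _ rC0) _.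
  have -> : (W%:C : C) = 2 * (U ^+ 2)%:C + (U ^+ 2)%:C.
    have c3 : (3 : R)%:C = 3 :> C by exact: (real_complex_nat 3).
    by rewrite /W rmorphM /= c3; ring.
  apply: lerD.
    rewrite wnormZ normr_nat; apply: ler_wpM2l; first exact: ler0n.
    apply: le_trans huv; apply: ler_wnorm; first exact: rC0.
    by rewrite ler_peMl // ler1n.
  exact: le_trans (wnorm_Xderiv _ rC0) huv.
have hgm m : cabs g`_m <= 2 ^+ k0.+2 * W * G' ^+ m.
  have := le_trans (coef_wnorm g m rC0) hg.
  rewrite -cabsE -rmorphXn -rmorphM lecR => h.
  rewrite -ler_pdivlMr in h; last by rewrite exprn_gt0.
  apply: le_trans h _; apply: ler_wpM2l.
    by apply: mulr_ge0; [exact: exprn_ge0|exact: W0].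
  by rewrite -exprVn lerXn2r ?nnegrE ?invr_ge0 ?(ltW rho0) // (le_trans ler01).
have hh n : (n < k0.+1)%N ->
  cabs (\sum_(k < n.+1) \sum_(l < k.+1 | (k + 2 * l0 == k0 + 2 * l)%N)
    a k l * (zcurve iC f k0.+1 ^+ (k - l) * zcurve (- iC) f k0.+1 ^+ l)`_n)
   <= G' ^+ (2 * n).+1.
  move=> nk; (* otherwise the frequency k0 - 2 l0 is too high to occur in order n *)
  have [h|h] := leqP k0 (n + 2 * l0); last first.
    rewrite big1 ?cabs_real ?normr0 ?exprn_ge0 ?(le_trans ler01) // => k _.
    rewrite big1 // => l /eqP h2; have hk := ltn_ord k.
    by exfalso; clear -h h2 hk; lia.
  have -> : \sum_(k < n.+1) \sum_(l < k.+1 | (k + 2 * l0 == k0 + 2 * l)%N)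
    a k l * (zcurve iC f k0.+1 ^+ (k - l) * zcurve (- iC) f k0.+1 ^+ l)`_n =
    (trig_poly a f k0.+1 n)`_(n + 2 * l0 - k0).
    rewrite /trig_poly coef_sum; apply: eq_bigr => k _; rewrite coef_sum big_mkcond.
    apply: eq_bigr => l _; rewrite coefZ coefXn.
    have -> : (n + 2 * l0 - k0 == n - k + 2 * l)%N = (k + 2 * l0 == k0 + 2 * l)%N.
      have kn : (k <= n)%N by rewrite -ltnS.
      by clear -h kn; apply/eqP/eqP; lia.
    by case: ifP => _; rewrite ?mulr1 ?mulr0.
  apply: le_trans (hG _ _ _ nk) _.
  by rewrite lerXn2r ?nnegrE ?(le_trans ler01).
have h2 : cabs (2 * a k0 l0) <= (k0.+1)%:R * (2 ^+ k0.+2 * W * G' ^+ (2 * k0).+1).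
  rewrite E; apply: le_trans (cabs_sum _) _.
  rewrite mulr_natl -[X in _ *+ X](card_ord k0.+1) -sumr_const.
  apply: ler_sum => n _; rewrite cabsM.
  have kn := ltn_ord n; rewrite ltnS in kn.
  apply: le_trans (ler_pM (cabs_ge0 _) (cabs_ge0 _) (hh _ (ltn_ord n)) (hgm _)) _.
  rewrite mulrCA; apply: ler_wpM2l.
    by apply: mulr_ge0; [exact: exprn_ge0|exact: W0].
  by rewrite -exprD; apply: ler_weXn2l; [exact: G'1|clear -kn; lia].
rewrite cabsM -real_complex2 cabs_real normr_nat in h2.
have h3 : (k0.+1)%:R <= 2 ^+ k0 :> R by rewrite -natrX ler_nat ltn_expl.
have G0 : 0 <= G' by apply: le_trans G'1.
have h4 : 2 * cabs (a k0 l0) <= 2 * (4 * G' ^+ 2 * (W + 1)) ^+ k0.+1.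
  apply: le_trans h2 _.
  have e0 m (c : R) : 0 <= c -> 0 <= c ^+ m by exact: exprn_ge0.
  have X0 : 0 <= 2 ^+ k0.+2 * W * G' ^+ (2 * k0).+1.
    by apply: mulr_ge0; [apply: mulr_ge0 => //; exact: e0|exact: e0].
  apply: (@le_trans _ _ (2 ^+ k0 * (2 ^+ k0.+2 * W * G' ^+ (2 * k0).+1))).
    by apply: ler_wpM2r.
  have -> : 2 ^+ k0 * (2 ^+ k0.+2 * W * G' ^+ (2 * k0).+1) =
      4 ^+ k0.+1 * G' ^+ (2 * k0).+1 * W.
    have -> : (4 : R) = 2 * 2 by lra.
    by rewrite !exprMn !exprS; ring.
  have W1 : 0 <= W + 1 by exact: addr_ge0.
  have Y0 : 0 <= 4 ^+ k0.+1 * G' ^+ (2 * k0.+1) * (W + 1) ^+ k0.+1.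
    by apply: mulr_ge0; [apply: mulr_ge0; exact: e0|exact: e0].
  have -> : (4 * G' ^+ 2 * (W + 1)) ^+ k0.+1 =
      4 ^+ k0.+1 * G' ^+ (2 * k0.+1) * (W + 1) ^+ k0.+1.
    by rewrite exprMn [(4 * _) ^+ _]exprMn exprM.
  apply: (@le_trans _ _ (4 ^+ k0.+1 * G' ^+ (2 * k0.+1) * (W + 1) ^+ k0.+1)).
    apply: ler_pM => //; first by apply: mulr_ge0; exact: e0.
      apply: ler_wpM2l; first exact: e0.
      by apply: ler_weXn2l; [exact: G'1|clear; lia].
    apply: (@le_trans _ _ (W + 1)); first by rewrite lerDl.
    rewrite exprS ler_peMr // exprn_ege1 //.
    by rewrite lerDr.
  by rewrite ler_peMl //; lra.
by rewrite ler_pM2l in h4.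
Qed.

(** Evaluate the change of coordinates at (X, 1): each factor X + i or
X - i has norm 2 for r = 1. *)
Lemma real_coef_bound a b (L : R) : 1 <= L ->
  (forall k, \sum_(i < k.+1) (b i (k - i)%N)%:C *: 'X^i =
    \sum_(l < k.+1) a k l *: (('X + iC%:P) ^+ (k - l) * ('X - iC%:P) ^+ l)) ->
  (forall k l, (l <= k)%N -> cabs (a k l) <= L ^+ k.+1) ->
  forall i j, `|b i j| <= (4 * L) ^+ (i + j).+1.
Proof.
move=> L1 hab ha i j; set k := (i + j)%N.
have ik : (i < k.+1)%N by rewrite ltnS leq_addr.
have n1 : `|iC| = 1 by rewrite -cabsE cabs_def expr0n expr1n add0r sqrtr1.
set q := \sum_(l < k.+1) a k l *: (('X + iC%:P) ^+ (k - l) * ('X - iC%:P) ^+ l).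
have Eb : (b i j)%:C = q`_i.
  rewrite /q -hab coef_sum (bigD1 (Ordinal ik)) //= big1 => [|m mi].
    by rewrite addr0 coefZ coefXn eqxx mulr1 /k addKn.
  rewrite coefZ coefXn; case: eqP => [e|_]; last by rewrite mulr0.
  by case/eqP: mi; apply: val_inj.
rewrite -lecR -cabs_real cabsE Eb.
have := coef_wnorm q i (ler01 : 0 <= 1 :> C); rewrite expr1n mulr1 => h.
apply: le_trans h _; apply: le_trans (wnorm_sum _ _ _ ler01) _.
have w2 (s : C) m : `|s| = 1 -> wnorm 1 (('X + s%:P) ^+ m) <= 2 ^+ m.
  move=> s1; apply: le_trans (wnormX_le _ _ ler01) _.
  rewrite lerXn2r ?nnegrE ?wnorm_ge0 //; apply: le_trans (wnormD _ _ ler01) _.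
  by rewrite wnormX wnormC s1.
apply: (@le_trans _ _ (\sum_(l < k.+1) (L ^+ k.+1 * 2 ^+ k)%:C)).
  apply: ler_sum => l _; rewrite wnormZ -cabsE rmorphM /=.
  have lk : (l <= k)%N by rewrite -ltnS.
  apply: ler_pM; rewrite ?wnorm_ge0 ?ler0c ?cabs_ge0 //; first by rewrite lecR ha.
  apply: le_trans (wnormM _ _ ler01) _.
  have -> : (2 ^+ k)%:C = 2 ^+ (k - l) * 2 ^+ l :> C.
    by rewrite -exprD subnK // rmorphXn /= real_complex2.
  apply: ler_pM; rewrite ?wnorm_ge0 //; first exact: w2.
  by rewrite -polyCN; apply: w2; rewrite normrN.
rewrite sumr_const card_ord -rmorphMn lecR -mulr_natl.
have h3 : (k.+1)%:R <= 2 ^+ k :> R by rewrite -natrX ler_nat ltn_expl.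
have L0 : 0 <= L by apply: le_trans L1.
apply: (@le_trans _ _ (2 ^+ k * (L ^+ k.+1 * 2 ^+ k))).
  by rewrite ler_wpM2r // mulr_ge0 // exprn_ge0.
have -> : 2 ^+ k * (L ^+ k.+1 * 2 ^+ k) = 4 ^+ k * L ^+ k.+1 :> R.
  have -> : (4 : R) = 2 * 2 by lra.
  by rewrite exprMn; ring.
rewrite exprMn ler_wpM2r ?exprn_ge0 // exprS ler_peMl ?exprn_ge0 //; lra.
Qed.

Lemma formal_series_bound b f (T : set R) (r M delta Bd : R) :
  f 0%N = 0 -> 0 < r -> 0 <= M ->
  (forall N, wnorm r (\poly_(i < N) f i) <= M) ->
  T `<=` [set x | 0 <= x <= 2 * pi] -> 0 < delta ->
  (forall s : seq R, (forall c : R, c \in s -> `|c| <= 12) ->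
      exists x, T x /\ delta ^+ size s <= \prod_(c <- s) `|x - c|) ->
  (forall th N n, T th -> (n < N)%N ->
     `|(psum2_poly b N (xcurve f N th) (ycurve f N th))`_n| <= Bd ^+ n.+1) ->
  exists L, 0 < L /\ forall i j, `|b i j| <= L ^+ (i + j).+1.
Proof.
move=> f0 r0 M0 hM sT d0 HT hB.
have [a [ha hab]] := psum2_conj b.
have [L [L0 hL]] := bernstein_walsh_coef sT d0 HT.
pose G := Num.max 1 (Num.max `|Bd| L).
have G1 : 1 <= G by rewrite le_max lexx.
have BG : `|Bd| <= G by rewrite !le_max lexx !orbT.
have LG : L <= G by rewrite !le_max lexx !orbT.
have G0 : 0 <= G by apply: le_trans G1.
have [L' [L'1 hL']] : exists L', 1 <= L' /\
    forall k l, (l <= k)%N -> cabs (a k l) <= L' ^+ k.+1.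
  apply: (@conj_coef_bound a f r M (G ^+ 2)) => //; first by rewrite exprn_ege1.
  move=> N n s nN; apply: le_trans (hL _ (G ^+ n.+1) _ s) _.
    move=> th Tth; rewrite -(trig_polyE th f0 nN ha) cabsM.
    have -> : cabs (cis th ^+ n) = 1.
      elim: n {nN s} => [|n IH]; first by rewrite expr0 cabs_real normr1.
      by rewrite exprS cabsM cabs_cis IH mulr1.
    rewrite mul1r cabs_real; apply: le_trans (hB _ _ _ Tth nN) _.
    apply: le_trans (ler_norm _) _; rewrite normrX.
    by rewrite lerXn2r ?nnegrE.
  apply: (@le_trans _ _ (G ^+ n.+1 * G ^+ (2 * n))).
    rewrite ler_wpM2l ?exprn_ge0 //.
    apply: (@le_trans _ _ (G ^+ (size (trig_poly a f N n)).-1)).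
      by rewrite lerXn2r ?nnegrE // ltW.
    by apply: ler_weXn2l => //; exact: size_trig_poly.
  by rewrite -exprD -exprM; apply: ler_weXn2l; [exact: G1|clear; lia].
exists (4 * L'); split; first by rewrite mulr_gt0 // (lt_le_trans ltr01).
exact: real_coef_bound hab hL'.
Qed.

End FormalBound.

(** * Analytic functions along the rotated curves *)

Section CurveJets.
Variable R : realType.
Implicit Types (D I : set R) (phi : R -> R) (th t r M : R) (N : nat).

Definition curve phi th t : R * R :=
  (t * cos th + phi t * sin th, - t * sin th + phi t * cos th).

Lemma jet_sub D D' r r' N H p M : 0 < r' -> r' <= r -> D' `<=` D ->
  jet D r N H p M -> jet D' r' N H p M.
Proof.
move=> r'0 rr DD [e [e0 he h]]; exists e; split=> //.
  by apply: le_trans he; rewrite lerD2r ler_wnorm // ltW.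
move=> t Dt tr; apply: le_trans (h _ (DD _ Dt) (le_trans tr rr)) _.
have r0 : 0 < r := lt_le_trans r'0 rr.
apply: ler_wpM2l => //; apply: lerXn2r; rewrite ?nnegrE.
- exact: divr_ge0 (normr_ge0 _) (ltW r0).
- exact: divr_ge0 (normr_ge0 _) (ltW r'0).
by rewrite ler_wpM2l // lef_pV2 ?posrE.
Qed.

Lemma jet_pred D r N H p M : 0 < r -> jet D r N.+1 H p M -> jet D r N H p M.
Proof.
move=> r0 [e [e0 he h]]; exists e; split=> // t Dt tr.
apply: le_trans (h _ Dt tr) _; apply: ler_wpM2l => //.
by apply: ler_wiXn2l => //; have /andP[] := frac_le1 r0 tr.
Qed.

Lemma curve_jets I phi t0 : I t0 -> analytic_on1 I phi ->
  exists (f : nat -> R) r M, [/\ 0 < r, 0 <= M,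
    (forall N, wnorm r (\poly_(i < N) f i) <= M), f 0%N = phi t0 &
    forall th N, (0 < N)%N ->
      jet [set t | I (t0 + t)] r N
        (fun t => (curve phi th (t0 + t)).1 - (curve phi th t0).1)
        (xcurve f N th - (phi t0 * sin th)%:P) M /\
      jet [set t | I (t0 + t)] r N
        (fun t => (curve phi th (t0 + t)).2 - (curve phi th t0).2)
        (ycurve f N th - (phi t0 * cos th)%:P) M].
Proof.
move=> It0 an; have [f [r [M [r0 M0 hj]]]] := analytic_on1_jet an It0.
have hw N : wnorm r (\poly_(i < N) f i) <= M.
  by have [e [e0 he _]] := hj N; apply: le_trans he; rewrite lerDl.
exists f, r, (r + M + `|phi t0|); split=> //.
- by rewrite !addr_ge0 // ltW.
- move=> N; apply: le_trans (hw N) _; rewrite -addrA addrCA lerDl.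
  by rewrite addr_ge0 // ltW.
- have := jet_coef0 (isT : (0 < 1)%N) r0 _ (hj 1%N).
  by rewrite /= addr0 coef_poly => /(_ It0).
move=> th N N0.
have jX : jet [set t | I (t0 + t)] r N id 'X r.
  rewrite -[X in jet _ _ _ _ _ X](wnormX r); apply: eq_jet (jet_poly _ _ _ _) => t _ _.
  by rewrite hornerX.
have small (c s d : R) : `|c| <= 1 -> `|s| <= 1 -> `|d| <= 1 ->
    `|c| * r + `|s| * M + `|- (phi t0 * d)| <= r + M + `|phi t0|.
  move=> c1 s1 d1; rewrite normrN normrM; apply: lerD; last by rewrite ler_piMr.
  by apply: lerD; rewrite ler_piMl // ltW.
split.
  apply: jet_le (small (cos th) (sin th) (sin th) (cos_max _) (sin_max _) (sin_max _)) _.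
  rewrite -polyCN /xcurve.
  apply: eq_jet (jetD r0 (jetD r0 (jetZ (cos th) r0 jX) (jetZ (sin th) r0 (hj N)))
    (jet_const _ r N (- (phi t0 * sin th)))) => t _ _ /=.
  by ring.
have sN : `|- sin th| <= 1 by rewrite normrN sin_max.
apply: jet_le (small (- sin th) (cos th) (cos th) sN (cos_max _) (cos_max _)) _.
rewrite -polyCN /ycurve.
apply: eq_jet (jetD r0 (jetD r0 (jetZ (- sin th) r0 jX) (jetZ (cos th) r0 (hj N)))
    (jet_const _ r N (- (phi t0 * cos th)))) => t _ _ /=.
by ring.
Qed.

(** The radius r' does not depend on the angle, the outer function or the
order. At t0 = 0 with phi 0 = 0 the constants subtracted from the curve
polynomials vanish. *)
Lemma curve_comp_jet I phi t0 : I t0 -> analytic_on1 I phi ->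
  exists (f : nat -> R) r M, [/\ 0 < r, 0 <= M,
    (forall N, wnorm r (\poly_(i < N) f i) <= M), f 0%N = phi t0 &
    forall s, 0 < s -> exists r', 0 < r' /\
      forall th N g b Mg, (0 < N)%N -> 0 <= Mg ->
        expands_to g (curve phi th t0) b s Mg N ->
        jet [set t | I (t0 + t)] r' N (fun t => g (curve phi th (t0 + t)))
          (psum2_poly b N (xcurve f N th - (phi t0 * sin th)%:P)
                     (ycurve f N th - (phi t0 * cos th)%:P)) (Mg + Mg)].
Proof.
move=> It0 an; have [f [r [M [r0 M0 hw f0 hj]]]] := curve_jets It0 an.
exists f, r, M; split=> // s s0.
pose l := Num.min 1 (s / (M + 1)).
have M1 : 0 < M + 1 by rewrite ltr_wpDl.
have l0 : 0 < l by rewrite lt_min ltr01 divr_gt0.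
have l1 : l <= 1 by rewrite ge_min lexx.
have l01 : 0 < l <= 1 by rewrite l0.
have ls : l * M <= s.
  have h : l <= s / (M + 1) by rewrite ge_min lexx orbT.
  apply: le_trans (ler_wpM2r M0 h) _.
  by rewrite mulrAC ler_pdivrMr // ler_wpM2l ?(ltW s0) // lerDl.
have lr0 : 0 < l * r by rewrite mulr_gt0.
exists (l * r); split=> // th N g b Mg N0 Mg0 hg.
have [jx jy] := hj th N N0.
have D0 : [set t | I (t0 + t)] 0 by rewrite /= addr0.
have cx := jet_coef0 N0 r0 D0 jx; rewrite addr0 subrr in cx.
have cy := jet_coef0 N0 r0 D0 jy; rewrite addr0 subrr in cy.
have jx' := jet_le ls (jet_shrink r0 l01 N0 cx jx).
have jy' := jet_le ls (jet_shrink r0 l01 N0 cy jy).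
apply: eq_jet (jet_comp2 lr0 s0 Mg0 hg jx' jy' _ _).
- move=> t _ _; congr g; rewrite [RHS]surjective_pairing; congr pair; ring.
- by move=> t Dt tr; apply: (jet_norm_coef0 lr0 N0 jx').
- by move=> t Dt tr; apply: (jet_norm_coef0 lr0 N0 jy').
Qed.

Lemma ujet_analytic_comp I phi t0 th g : I t0 -> analytic_on1 I phi ->
  analytic_at2 g (curve phi th t0) ->
  ujet [set t | I (t0 + t)] (fun t => g (curve phi th (t0 + t))).
Proof.
move=> It0 an ang.
have [f [r [M [r0 M0 hw f0 hc]]]] := curve_comp_jet It0 an.
have [b [s [Mg [s0 Mg0 hg]]]] := analytic_at2_expands ang.
have [r' [r'0 hj]] := hc _ s0.
exists r', (Mg + Mg); split=> //; first exact: addr_ge0.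
move=> N; eexists; apply: jet_pred r'0 _.
exact: hj (hg N.+1).
Qed.

Lemma ujetB D H H' : ujet D H -> ujet D H' -> ujet D (fun t => H t - H' t).
Proof.
move=> [r [M [r0 M0 h]]] [r' [M' [r'0 M'0 h']]].
have m0 : 0 < Num.min r r' by rewrite lt_min r0.
exists (Num.min r r'), (M + M'); split=> //; first exact: addr_ge0.
move=> N; have [p hp] := h N; have [p' hp'] := h' N.
exists (p + (-1) *: p').
have j1 : jet D (Num.min r r') N H p M.
  by apply: jet_sub hp => //; rewrite ge_min lexx.
have j2 : jet D (Num.min r r') N H' p' M'.
  by apply: jet_sub hp' => //; rewrite ge_min lexx orbT.
have := jetD m0 j1 (jetZ (-1) m0 j2); rewrite normrN1 mul1r.
by apply: eq_jet => t _ _; rewrite mulN1r.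
Qed.

Lemma ujet_sub D D' H H' : D' `<=` D -> (forall t, D' t -> H t = H' t) ->
  ujet D H -> ujet D' H'.
Proof.
move=> DD HH [r [M [r0 M0 h]]]; exists r, M; split=> // N.
have [p hp] := h N; exists p.
apply: (@eq_jet _ _ _ _ H); first by move=> t Dt _; exact: HH.
exact: jet_sub hp.
Qed.

(** Two jets of functions that agree near 0 have the same coefficients
below the order. *)
Lemma jet_coef_unique D r r' N H H' p p' M M' (rho : R) : 0 < r -> 0 < r' ->
  0 < rho -> (forall t, D t -> `|t| <= rho -> H t = H' t) ->
  jet D r N H p M -> jet D r' N H' p' M' -> accum0 D ->
  forall n, (n < N)%N -> p`_n = p'`_n.
Proof.
move=> r0 r'0 rho0 HH [e [e0 he h]] [e' [e'0 he' h']] aD n nN.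
pose m := Num.min rho (Num.min r r').
have m0 : 0 < m by rewrite !lt_min rho0 r0 r'0.
apply/eqP; rewrite -subr_eq0 -coefB; apply/eqP.
apply: (@flat_poly_coef0 _ D (p - p') (e / r ^+ N + e' / r' ^+ N) m N) => // t Dt.
rewrite !le_min => /and4P[_ t1 t2 t3]; rewrite hornerD hornerN.
have -> : p.[t] - p'.[t] = (H' t - p'.[t]) - (H t - p.[t]).
  by rewrite HH //; ring.
apply: le_trans (ler_normB _ _) _; rewrite mulrDl addrC; apply: lerD.
  by apply: le_trans (h _ Dt t2) _; rewrite expr_div_n [leRHS]mulrAC mulrA.
by apply: le_trans (h' _ Dt t3) _; rewrite expr_div_n [leRHS]mulrAC mulrA.
Qed.

Lemma jet_flat_diff D r r' N H H' p M M' : 0 < r -> 0 < r' ->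
  jet D r N H p M -> jet D r' N H' p M' ->
  exists C rho, 0 < rho /\
    forall t, D t -> `|t| <= rho -> `|H t - H' t| <= C * `|t| ^+ N.
Proof.
move=> r0 r'0 [e [e0 he h]] [e' [e'0 he' h']].
exists (e / r ^+ N + e' / r' ^+ N), (Num.min r r'); split.
  by rewrite lt_min r0.
move=> t Dt; rewrite le_min => /andP[t2 t3].
have -> : H t - H' t = (H t - p.[t]) - (H' t - p.[t]) by ring.
apply: le_trans (ler_normB _ _) _; rewrite mulrDl; apply: lerD.
  by apply: le_trans (h _ Dt t2) _; rewrite expr_div_n [leRHS]mulrAC mulrA.
by apply: le_trans (h' _ Dt t3) _; rewrite expr_div_n [leRHS]mulrAC mulrA.
Qed.

Definition measurable_coefs (P : R -> {poly R}) :=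
  forall n, measurable_fun [set: R] (fun th => (P th)`_n).

Lemma measurable_coefsM P Q : measurable_coefs P -> measurable_coefs Q ->
  measurable_coefs (fun th => P th * Q th).
Proof.
move=> mP mQ n; under eq_fun do rewrite coefM.
by apply: measurable_sum => i; apply: measurable_funM.
Qed.

Lemma measurable_coefs_exp P k : measurable_coefs P -> measurable_coefs (fun th => P th ^+ k).
Proof.
move=> mP; elim: k => [|k IH].
  by move=> n; under eq_fun do rewrite expr0; exact: measurable_cst.
have -> : (fun th => P th ^+ k.+1) = (fun th => P th * P th ^+ k).
  by apply/funext => th; rewrite exprS.
exact: measurable_coefsM.
Qed.

Lemma measurable_coefsZ (c : R -> R) P : measurable_fun setT c -> measurable_coefs P ->
  measurable_coefs (fun th => c th *: P th).
Proof.
move=> mc mP n; under eq_fun do rewrite coefZ.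
exact: measurable_funM.
Qed.

Lemma measurable_coefs_psum2 b N P Q : measurable_coefs P -> measurable_coefs Q ->
  measurable_coefs (fun th => psum2_poly b N (P th) (Q th)).
Proof.
move=> mP mQ n; rewrite /psum2_poly; under eq_fun do rewrite coef_sum.
apply: measurable_sum => k; under eq_fun do rewrite coef_sum.
apply: measurable_sum => i; move: n; apply: measurable_coefsZ; first exact: measurable_cst.
by apply: measurable_coefsM; exact: measurable_coefs_exp.
Qed.

Lemma measurable_cosR : measurable_fun [set: R] (@cos R).
Proof. by apply: continuous_measurable_fun; exact: continuous_cos. Qed.

Lemma measurable_sinR : measurable_fun [set: R] (@sin R).
Proof. by apply: continuous_measurable_fun; exact: continuous_sin. Qed.

Lemma measurable_coefs_xcurve f N : measurable_coefs (xcurve f N).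
Proof.
move=> n; rewrite /xcurve; under eq_fun do rewrite coefD !coefZ.
apply: measurable_funD; apply: measurable_funM => //;
  [exact: measurable_cosR|exact: measurable_sinR].
Qed.

Lemma measurable_coefs_ycurve f N : measurable_coefs (ycurve f N).
Proof.
move=> n; rewrite /ycurve; under eq_fun do rewrite coefD !coefZ.
apply: measurable_funD; apply: measurable_funM => //; last exact: measurable_cosR.
by apply: measurable_funN; exact: measurable_sinR.
Qed.

End CurveJets.

(** * The theorem for real-valued functions *)

Section RealTheorem.
Variable R : realType.
Implicit Types (I E : set R) (phi : R -> R) (g : R * R -> R).

(** A nondegenerate interval containing 0 has a nonzero point, and then
the segment from 0 to it. *)
Lemma accum0_interval I : is_interval I -> I 0 ->
  (exists s t : R, [/\ I s, I t & s < t]) -> accum0 I.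
Proof.
move=> iI I0 [s [t [Is It st]]] eps eps0.
have [u [Iu u0]] : exists u, I u /\ u != 0.
  have [s0|s0] := eqVneq s 0; last by exists s.
  by exists t; split=> //; rewrite gt_eqF // -s0.
have nu : 0 < `|u| by rewrite normr_gt0.
pose l := Num.min 1 (eps / (2 * `|u|)).
have l0 : 0 < l by rewrite lt_min ltr01 divr_gt0 // mulr_gt0.
have l1 : l <= 1 by rewrite ge_min lexx.
exists (l * u); split.
  by apply: interval_scale => //; rewrite ltW.
rewrite normrM (gtr0_norm l0) mulr_gt0 //=.
apply: (@le_lt_trans _ _ (eps / 2)); last lra.
rewrite -ler_pdivlMr // -mulrA -invfM; by rewrite ge_min lexx orbT.
Qed.

Lemma curve_rot I phi th t : I t -> rot_curve I phi th (curve phi th t).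
Proof. by move=> It; exists t. Qed.

Lemma curve0 phi th : phi 0 = 0 -> curve phi th 0 = (0, 0).
Proof. by move=> p0; rewrite /curve p0 oppr0 !mul0r addr0. Qed.

(** A rotation preserves t^2 + phi(t)^2. *)
Lemma curve_norm_ge phi th t rho : `|(curve phi th t).1| < rho ->
  `|(curve phi th t).2| < rho -> `|t| < 2 * rho.
Proof.
set p := curve phi th t => p1 p2.
have rho0 : 0 < rho by apply: le_lt_trans p1.
have E : p.1 ^+ 2 + p.2 ^+ 2 = t ^+ 2 + phi t ^+ 2.
  have := cos2Dsin2 th; rewrite /p /curve /= => h.
  transitivity ((t ^+ 2 + phi t ^+ 2) * (cos th ^+ 2 + sin th ^+ 2)); first ring.
  by rewrite h mulr1.
have h1 : p.1 ^+ 2 <= rho ^+ 2.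
  by rewrite -(real_normK (num_real p.1)) lerXn2r ?nnegrE // ltW.
have h2 : p.2 ^+ 2 <= rho ^+ 2.
  by rewrite -(real_normK (num_real p.2)) lerXn2r ?nnegrE // ltW.
have h3 : `|t| ^+ 2 <= 2 * rho ^+ 2.
  rewrite real_normK ?num_real //; have := sqr_ge0 (phi t); lra.
rewrite ltNge; apply/negP => h.
have : (2 * rho) ^+ 2 <= `|t| ^+ 2 by rewrite lerXn2r ?nnegrE // mulr_ge0 // ltW.
rewrite exprMn; have : 0 < rho ^+ 2 by rewrite exprn_gt0.
have -> : (2 : R) ^+ 2 = 4 by ring.
lra.
Qed.

Lemma curve_small I phi : I 0 -> analytic_on1 I phi -> phi 0 = 0 ->
  forall beta : R, 0 < beta -> exists delta, 0 < delta /\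
    forall th t, I t -> `|t| < delta ->
      `|(curve phi th t).1| < beta /\ `|(curve phi th t).2| < beta.
Proof.
move=> I0 an p0 beta beta0.
have [f [r [M [r0 M0 hj]]]] := analytic_on1_jet an I0.
have c0 : (\poly_(i < 1) f i)`_0 = 0.
  by rewrite (jet_coef0 _ r0 _ (hj 1%N)) //= ?addr0.
pose K := 1 + M / r.
have K0 : 0 < K by rewrite ltr_wpDr // divr_ge0 // ltW.
exists (Num.min r (beta / K)); split; first by rewrite lt_min r0 divr_gt0.
move=> th t It; rewrite lt_min => /andP[tr]; rewrite ltr_pdivlMr // => tb.
have pt : `|phi t| <= M * (`|t| / r).
  have := jet_norm_coef0 r0 (isT : (0 < 1)%N) (hj 1%N) c0 (t := t); rewrite /= add0r.
  by apply=> //; exact: ltW.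
have small (c s : R) : `|c| <= 1 -> `|s| <= 1 -> `|t * c + phi t * s| < beta.
  move=> c1 s1; apply: le_lt_trans (ler_normD _ _) _; rewrite !normrM.
  apply: le_lt_trans tb; rewrite /K mulrDr mulr1; apply: lerD.
    by rewrite ler_piMr.
  by apply: le_trans (_ : `|phi t| <= _); rewrite ?ler_piMr // mulrCA.
split; rewrite /curve /=; first by apply: small; rewrite ?cos_max ?sin_max.
by rewrite mulNr -mulrN; apply: small; rewrite ?normrN ?cos_max ?sin_max.
Qed.

Lemma taylor_expands (U : set (R * R)) g N : open U -> U (0, 0) -> Ck_on N U g ->
  exists s M, [/\ 0 < s, 0 <= M & expands_to g (0, 0) (tcoef g) s M N].
Proof.
move=> oU U0 /(taylor2 oU U0) [C [rho [C0 rho0 h]]].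
have a0 : 0 <= psum2_abs (tcoef g) N rho.
  by apply: sumr_ge0 => n _; apply: sumr_ge0 => i _; rewrite mulr_ge0 // exprn_ge0 // ltW.
have c0 : 0 <= C * rho ^+ N by rewrite mulr_ge0 // exprn_ge0 // ltW.
exists rho, (psum2_abs (tcoef g) N rho + C * rho ^+ N); split=> //; first exact: addr_ge0.
split; first by rewrite lerDl.
move=> x y xr yr; rewrite !add0r; apply: le_trans (h _ _ xr yr) _.
have m0 : 0 <= Num.max `|x| `|y| by rewrite le_max normr_ge0.
rewrite expr_div_n mulrDl ler_wpDl //.
  by rewrite mulr_ge0 // divr_ge0 ?exprn_ge0 // ltW.
rewrite -mulrA ler_wpM2l // mulrCA mulfV ?mulr1 // expf_neq0 // gt_eqF //.
Qed.

(** The Taylor polynomials of the smooth function g and those of the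
analytic function G give jets of the same function of t, so their coefficients
agree, and those of G grow geometrically. *)
Lemma coef_growth_bound I phi (f : nat -> R) g (G : R * R -> R)
    (U : set (R * R)) th (r : R) :
  accum0 I -> open U -> U (0, 0) -> (forall k, Ck_on k U g) ->
  (forall s, 0 < s -> exists r', 0 < r' /\
      forall th N g b Mg, (0 < N)%N -> 0 <= Mg ->
        expands_to g (0, 0) b s Mg N ->
        jet I r' N (fun t => g (curve phi th t))
          (psum2_poly b N (xcurve f N th) (ycurve f N th)) (Mg + Mg)) ->
  analytic_at2 G (0, 0) ->
  0 < r -> (forall t, I t -> `|t| <= r -> g (curve phi th t) = G (curve phi th t)) ->
  exists m : nat, forall N n, (n < N)%N ->
    `|(psum2_poly (tcoef g) N (xcurve f N th) (ycurve f N th))`_n| <= m%:R ^+ n.+1.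
Proof.
move=> aI oU U0 gU hc anG r0 hgG.
have [b [s [MG [s0 MG0 hG]]]] := analytic_at2_expands anG.
have [r2 [r20 hj2]] := hc _ s0.
pose B := Num.max (MG + MG) (Num.max r2^-1 1).
have [m hm] : exists m : nat, B <= m%:R.
  by exists (Num.truncn B).+1; rewrite ltW // truncnS_gt.
exists m => N n nN.
have N0 : (0 < N)%N by apply: leq_ltn_trans nN.
have [s1 [M1 [s10 M10 h1]]] := taylor_expands oU U0 (gU N).
have [r1 [r10 hj1]] := hc _ s10.
have J1 := hj1 th N g _ _ N0 M10 h1.
have J2 := hj2 th N G _ _ N0 MG0 (hG N).
have -> := jet_coef_unique r10 r20 r0 hgG J1 J2 aI nN.
have [e [e0 he _]] := J2.
set p := psum2_poly b N _ _ in he *.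
have h2 : `|p`_n| * r2 ^+ n <= MG + MG.
  apply: le_trans (coef_wnorm p n (ltW r20)) _.
  by apply: le_trans he; rewrite lerDl.
have m1 : MG + MG <= m%:R by apply: le_trans hm; rewrite /B le_max lexx.
have m2 : r2^-1 <= m%:R by apply: le_trans hm; rewrite /B !le_max lexx !orbT.
rewrite exprS; rewrite -ler_pdivlMr ?exprn_gt0 // in h2.
apply: le_trans h2 _; apply: ler_pM => //; first exact: addr_ge0.
  by rewrite invr_ge0 exprn_ge0 // ltW.
by rewrite -exprVn lerXn2r ?nnegrE // invr_ge0 ltW.
Qed.

(** E is the countable union over m of the sets on which the bound m holds,
so one of them has positive measure. *)
Lemma uniform_bound_piece E (c : nat -> nat -> R -> R) (mu : probability (R * R)%type R) :
  closed E -> mu (real_axis_set E) = 1%E ->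
  (forall N n, measurable_fun setT (c N n)) ->
  (forall th, E th -> exists m : nat, forall N n, (n < N)%N ->
     `|c N n th| <= m%:R ^+ n.+1) ->
  exists m : nat,
    let B := [set p : R * R | real_axis_set E p /\
       forall N n, (n < N)%N -> `|c N n p.1| <= m%:R ^+ n.+1] in
    [/\ measurable B, B `<=` real_axis_set E & (0 < mu B)%E].
Proof.
move=> cE mu1 mc hE.
pose B m := [set p : R * R | real_axis_set E p /\
       forall N n, (n < N)%N -> `|c N n p.1| <= (m : nat)%:R ^+ n.+1].
have mB m : measurable (B m).
  have -> : B m = real_axis_set E `&`
      \bigcap_N \bigcap_n (if (n < N)%N
        then fst @^-1` [set th | `|c N n th| <= m%:R ^+ n.+1] else setT).
    apply/seteqP; split=> [p [Ep h]|p [Ep h]].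
      by split=> // N _ n _; case: ifP => // nN; exact: h.
    by split=> // N n nN; have := h N Logic.I n Logic.I; rewrite nN.
  apply: measurableI; first exact: measurable_real_axis_set.
  apply: bigcapT_measurable => N; apply: bigcapT_measurable => n.
  case: ifP => // _.
  rewrite -[X in measurable X]setTI; apply: measurable_fst => //.
  rewrite -[X in measurable X]setTI.
  have mf : measurable_fun setT (fun th => `|c N n th| <= m%:R ^+ n.+1).
    apply: measurable_fun_ler => //.
    exact: (measurableT_comp (f := @Num.norm R R)).
  exact: (mf measurableT [set true]).
have Bsub m : B m `<=` real_axis_set E by move=> p [].
have Bcup : real_axis_set E `<=` \bigcup_m B m.
  move=> _ [th Eth <-]; have [m hm] := hE th Eth.
  by exists m => //; split=> //; exists th.
apply: contrapT => /forallNP H.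
have B0 m : mu (B m) = 0%E.
  apply/eqP; rewrite eq_le measure_ge0 andbT leNgt; apply/negP => h.
  by apply: (H m); split; [exact: mB|exact: Bsub|].
have mcup : measurable (\bigcup_m B m) by exact: bigcup_measurable.
have : (mu (real_axis_set E) <= 0)%E.
  apply: (@le_trans _ _ (mu (\bigcup_m B m))).
    by apply: le_measure => //; rewrite inE //; exact: measurable_real_axis_set.
  apply: le_trans (generalized_Boole_inequality _ _ _) _ => //.
  by rewrite eseries0 // => i _ _; exact: B0.
by rewrite mu1 lee_fin ler10.
Qed.

Theorem real_valued_extension (Omega : set (R * R)) g I phi E :
  open Omega -> Omega (0, 0) -> (forall k, Ck_on k Omega g) ->
  is_interval I -> (exists s t : R, [/\ I s, I t & s < t]) -> I 0 ->
  analytic_on1 I phi -> phi 0 = 0 ->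
  closed E -> E `<=` [set x : R | 0 <= x <= 2 * pi] ->
  (0 < log_capacity (real_axis_set E))%E ->
  (forall th, E th -> exists (Q : set (R * R)) (G : R * R -> R),
     [/\ rot_curve I phi th `&` Omega `<=` Q,
         forall p, Q p -> analytic_at2 G p
       & forall p, (rot_curve I phi th `&` Omega) p -> g p = G p]) ->
  exists (rho : R) (F : R * R -> R), [/\ 0 < rho,
    forall p, `|p.1| < rho -> `|p.2| < rho -> Omega p,
    forall p, `|p.1| < rho -> `|p.2| < rho -> analytic_at2 F p
  & forall p, `|p.1| < rho -> `|p.2| < rho ->
      (\bigcup_(th in E) rot_curve I phi th) p -> g p = F p].
Proof.
move=> oO O0 gO iI nI I0 an p0 cE sE cap hE.
have aI := accum0_interval iI I0 nI.
have [rO [rO0 hO]] : exists r, 0 < r /\ forall x y, `|x| < r -> `|y| < r -> Omega (x, y).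
  have /nbhs_ballP[e /= e0 he] := open_nbhs_nbhs (conj oO O0).
  exists e; split=> // x y xe ye; apply: he; rewrite /ball /= /prod_ball /=.
  by split; rewrite /ball /= sub0r normrN.
have [dO [dO0 hdO]] := curve_small I0 an p0 rO0.
have curveO th t : I t -> `|t| < dO -> Omega (curve phi th t).
  move=> It td; have [h1 h2] := hdO th t It td.
  by rewrite [curve _ _ _]surjective_pairing; exact: hO.
have [f [r [M [r0 M0 hw f0 hc0]]]] := curve_comp_jet I0 an.
rewrite p0 in f0.
have I00 : [set t | I (0 + t)] = I by apply/seteqP; split=> t /=; rewrite add0r.
have hc : forall s, 0 < s -> exists r', 0 < r' /\
      forall th N g b Mg, (0 < N)%N -> 0 <= Mg ->
        expands_to g (0, 0) b s Mg N ->
        jet I r' N (fun t => g (curve phi th t))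
          (psum2_poly b N (xcurve f N th) (ycurve f N th)) (Mg + Mg).
  move=> s s0; have [r' [r'0 h]] := hc0 s s0; exists r'; split=> // th N g' b Mg N0 Mg0 h2.
  have := h th N g' b Mg N0 Mg0; rewrite curve0 // I00 p0 !mul0r !subr0 => /(_ h2).
  by apply: eq_jet => t _ _; rewrite add0r.
pose c N n th := (psum2_poly (tcoef g) N (xcurve f N th) (ycurve f N th))`_n.
have hcb th : E th -> exists m : nat, forall N n, (n < N)%N ->
     `|c N n th| <= m%:R ^+ n.+1.
  move=> Eth; have [Q [G [QO anG gG]]] := hE th Eth.
  apply: (@coef_growth_bound I phi f g G Omega th (dO / 2)) => //.
  - by apply: anG; apply: QO; split=> //; rewrite -(curve0 th p0); exact: curve_rot.
  - by rewrite divr_gt0.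
  - move=> t It td; apply: gG; split; first exact: curve_rot.
    by apply: curveO => //; lra.
have [mu [mu1 hmu]] := capacity_product_ge cE sE cap.
have mc N n : measurable_fun setT (c N n).
  by apply: measurable_coefs_psum2; [exact: measurable_coefs_xcurve|exact: measurable_coefs_ycurve].
have [m [mB Bsub muB]] := uniform_bound_piece cE mu1 mc hcb.
set B := [set p : R * R | _] in mB Bsub muB.
have [delta [delta0 hdelta]] := hmu B mB Bsub muB.
pose T := [set x | B (x, 0)].
have TE x : T x -> E x by move=> /Bsub [x' Ex' /(congr1 fst) /= <-].
have [L [L0 hL]] : exists L, 0 < L /\ forall i j, `|tcoef g i j| <= L ^+ (i + j).+1.
  apply: (@formal_series_bound R (tcoef g) f T r M delta m%:R) => //.
  - by move=> x /TE /sE.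
  - by move=> th N n [_ h] nN; exact: h.
have [s s0 hs] : exists2 s : R, 0 < s & forall N, psum2_abs (tcoef g) N s <= 2 * L.
  exists (4 * L)^-1; first by rewrite invr_gt0 mulr_gt0.
  by move=> N; exact: psum2_abs_geo_le.
have L20 : 0 <= 2 * L by rewrite mulr_ge0 // ltW.
pose F (p : R * R) : R := limn (fun K => psum2 (tcoef g) K p.1 p.2).
have cF x y : `|x| <= s -> `|y| <= s ->
    (fun K => psum2 (tcoef g) K x y) @ \oo --> F (x, y).
  by move=> xs ys; exact: (psum2_cvg s0 hs xs ys).
have anF p : `|p.1| <= s / 2 -> `|p.2| <= s / 2 -> analytic_at2 F p.
  move=> h1 h2; have [d hd] := expands_recenter s0 hs cF h1 h2.
  by apply: expands_analytic_at2 hd => //; rewrite divr_gt0.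
have expF N : expands_to F (0, 0) (tcoef g) s (2 * L) N.
  split; first exact: hs.
  move=> x y xs ys; rewrite /F /= !add0r; apply: (lim_dist_le (N := N)).
    exact: (psum2_cvg s0 hs xs ys).
  by move=> K NK; apply: psum2_diff_le.
pose beta := Num.min rO (s / 2).
have beta0 : 0 < beta by rewrite lt_min rO0 divr_gt0.
have bO : beta <= rO by rewrite ge_min lexx.
have bs : beta <= s / 2 by rewrite ge_min lexx orbT.
have [d1 [d10 hd1]] := curve_small I0 an p0 beta0.
pose rho := Num.min beta (d1 / 2).
have rho0 : 0 < rho by rewrite lt_min beta0 divr_gt0.
have rb : rho <= beta by rewrite ge_min lexx.
have rd : rho <= d1 / 2 by rewrite ge_min lexx orbT.
exists rho, F; split=> //.
- move=> p h1 h2; rewrite [p]surjective_pairing; apply: hO.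
    by apply: lt_le_trans bO; apply: lt_le_trans rb.
  by apply: lt_le_trans bO; apply: lt_le_trans rb.
- move=> p h1 h2; apply: anF.
    by apply: ltW; apply: lt_le_trans bs; apply: lt_le_trans rb.
  by apply: ltW; apply: lt_le_trans bs; apply: lt_le_trans rb.
move=> p h1 h2 [th Eth [t It Ep]].
have {}Ep : p = curve phi th t by [].
rewrite Ep in h1 h2 *.
have td : `|t| < d1.
  by apply: lt_le_trans (curve_norm_ge h1 h2) _; lra.
(* the whole parameter interval is mapped into the domain of F, so the identity
   theorem applies on it *)
pose J := I `&` [set t | `|t| < d1].
have JI : J `<=` I by move=> u [].
have curveJ u : J u -> Omega (curve phi th u) /\ analytic_at2 F (curve phi th u).
  move=> [Iu ud]; have [k1 k2] := hd1 th u Iu ud; split.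
    rewrite [curve _ _ _]surjective_pairing; apply: hO.
      exact: lt_le_trans bO.
    exact: lt_le_trans bO.
  by apply: anF; apply: ltW; apply: lt_le_trans bs.
have [Q [G [QO anG gG]]] := hE th Eth.
apply/eqP; rewrite -subr_eq0; apply/eqP.
apply: (@ujet_identity R J (fun u => g (curve phi th u) - F (curve phi th u))) => //.
- move=> x y [Ix xd] [Iy yd] z /andP[xz zy]; split.
    by apply: (iI x y) => //; rewrite xz.
  move: xd yd; rewrite /= !ltr_norml => /andP[a1 a2] /andP[a3 a4].
  by apply/andP; split; lra.
- by split=> //=; rewrite normr0.
- move=> eps eps0; have [|u [Iu /andP[u0]]] := aI (Num.min eps d1).
    by rewrite lt_min eps0.
  by rewrite lt_min => /andP[ue ud]; exists u; rewrite u0 ue.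
- move=> t0 Jt0; have [Ot0 aF] := curveJ _ Jt0; have It0 := JI _ Jt0.
  have aG : analytic_at2 G (curve phi th t0).
    by apply: anG; apply: QO; split=> //; exact: curve_rot.
  apply: ujetB.
    apply: ujet_sub (ujet_analytic_comp It0 an aG).
      by move=> u [].
    move=> u Ju; apply/esym; apply: gG; split; first exact: curve_rot (JI _ Ju).
    by have [] := curveJ _ Ju.
  apply: ujet_sub (ujet_analytic_comp It0 an aF) => //.
  by move=> u [].
- move=> N.
  have [s1 [M1 [s10 M10 h3]]] := taylor_expands oO O0 (gO N.+1).
  have [r1 [r10 hj1]] := hc _ s10.
  have [r2 [r20 hj2]] := hc _ s0.
  have J1 := jet_pred r10 (hj1 th N.+1 g _ _ isT M10 h3).
  have J2 := jet_pred r20 (hj2 th N.+1 F _ _ isT L20 (expF N.+1)).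
  have [C [rho1 [rho10 hC]]] := jet_flat_diff r10 r20 J1 J2.
  exists C, rho1; split=> // u [Iu _] /andP[_ ur].
  exact: hC.
Qed.

End RealTheorem.

Unset Implicit Arguments.
Set Strict Implicit.

Theorem theorem2p2 (R : realType)
  (Omega : set (R * R)) (Omega_open : open Omega)
  (Omega0 : Omega (0, 0))
  (f : R * R -> R[i]) (f_smooth : smooth_on Omega f)
  (I : set R) (I_itv : is_interval I)
  (I_nondeg : exists s t : R, [/\ I s, I t & s < t])
  (I0 : I 0)
  (phi : R -> R) (phi_analytic : analytic_on1 I phi) (phi0 : phi 0 = 0)
  (E : set R) (E_closed : closed E)
  (E_sub : E `<=` [set x : R | 0 <= x <= 2 * pi])
  (E_cap : (0 < log_capacity (real_axis_set E))%E)
  (f_analytic_on_curves : forall theta : R, E theta ->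
     exists (Q : set (R * R)) (F_theta : R * R -> R[i]),
       [/\ open Q,
           rot_curve I phi theta `&` Omega `<=` Q,
           analytic_on2 Q F_theta
         & forall p : R * R,
             (rot_curve I phi theta `&` Omega) p -> f p = F_theta p]) :
  exists (U : set (R * R)) (F : R * R -> R[i]),
    [/\ open U,
        U (0, 0),
        U `<=` Omega,
        analytic_on2 U F
      & forall p : R * R,
          (U `&` \bigcup_(theta in E) rot_curve I phi theta) p -> f p = F p].
Proof.
have part (pr : R[i] -> R) (g := fun p => pr (f p)) :
    (forall k, Ck_on k Omega g) ->
    (forall Q F_theta, analytic_on2 Q F_theta ->
       forall p, Q p -> analytic_at2 (fun q => pr (F_theta q)) p) ->
    exists (rho : R) (F : R * R -> R), [/\ 0 < rho,
      forall p, `|p.1| < rho -> `|p.2| < rho -> Omega p,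
      forall p, `|p.1| < rho -> `|p.2| < rho -> analytic_at2 F p
    & forall p, `|p.1| < rho -> `|p.2| < rho ->
        (\bigcup_(th in E) rot_curve I phi th) p -> g p = F p].
  move=> gO anpr.
  apply: (@real_valued_extension R Omega g I phi E) => //.
  move=> th Eth; have [Q [G [_ QO anG fG]]] := f_analytic_on_curves th Eth.
  exists Q, (fun p => pr (G p)); split=> //; first exact: anpr anG.
  by move=> p hp; rewrite /g fG.
have [|r1 [F1 [r10 O1 an1 eq1]]] := part (@complex.Re R) (fun k => (f_smooth k).1).
  by move=> Q G anG p Qp; have [] := anG p Qp.
have [|r2 [F2 [r20 _ an2 eq2]]] := part (@complex.Im R) (fun k => (f_smooth k).2).
  by move=> Q G anG p Qp; have [] := anG p Qp.
pose r := Num.min r1 r2.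
have r0 : 0 < r by rewrite lt_min r10.
have rr1 : r <= r1 by rewrite ge_min lexx.
have rr2 : r <= r2 by rewrite ge_min lexx orbT.
pose U := [set p : R * R | `|p.1| < r /\ `|p.2| < r].
have U1 p : U p -> `|p.1| < r1 /\ `|p.2| < r1.
  by move=> [h1 h2]; split; apply: lt_le_trans rr1.
have U2 p : U p -> `|p.1| < r2 /\ `|p.2| < r2.
  by move=> [h1 h2]; split; apply: lt_le_trans rr2.
exists U, (fun p => Complex (F1 p) (F2 p)); split.
- have -> : U = ball ((0, 0) : R * R) r.
    apply/seteqP; split=> p; rewrite /U /ball /= /prod_ball /ball /=;
      by rewrite !sub0r !normrN.
  exact: ball_open.
- by rewrite /U /= normr0.
- by move=> p /U1[]; exact: O1.
- by move=> p Up; split; [have [] := U1 p Up; exact: an1|have [] := U2 p Up; exact: an2].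
- move=> p [Up Lp].
  have [a1 a2] := U1 p Up; have [b1 b2] := U2 p Up.
  have := eq1 p a1 a2 Lp; have := eq2 p b1 b2 Lp.
  by case: (f p) => u v /= -> ->.
Qed.
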